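(* Let $f$ be a real-valued polynomial of degree $2$, $q$ a prime and $\chi$ a non-principal multiplicative character modulo $q$. Then for every integer $r \ge 4$, every real $H < q^{\frac{1}{2} + \frac{1}{4(r-3)}}$ and every $\varepsilon > 0$, \[ \sum_{N<n \le N+H} e(f(n))\chi(n) \ll_{r,\varepsilon} H^{1-\frac{1}{r}} q^{\frac{r-2}{4r(r-3)} + \varepsilon}, \] uniformly in $N$.
   Context: $e(t) = e^{2\pi i t}$. The sum runs over integers $n \in (N,N+H]$; the implied constant depends only on $r$ and $\varepsilon$. *)

(* Defs.v *)
From HB Require Import structures.
From mathcomp Require Import all_boot all_order all_algebra.
From mathcomp Require Import complex.
From mathcomp Require Import all_classical all_reals all_analysis.

Set Implicit Arguments.
Unset Strict Implicit.
Unset Printing Implicit Defensive.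

Import Order.TTheory GRing.Theory Num.Theory.

Local Open Scope ring_scope.
Local Open Scope complex_scope.
Local Open Scope classical_set_scope.

Section Characters.
Variable R : realType.

(* e^{2 pi i t}, through Euler's formula *)
Definition e (t : R) : R[i] := cos (2 * pi * t) +i* sin (2 * pi * t).

Record dirichlet_character (q : nat) (chi : int -> R[i]) : Prop :=
  DirichletCharacter {
    dchar1 : chi 1 = 1;
    dcharM : forall m n : int, chi (m * n) = chi m * chi n;
    dchar_period : forall n : int, chi (n + q%:Z) = chi n;
    dchar_eq0 : forall n : int, chi n = 0 <-> ~~ coprimez n q%:Z
  }.

Definition principal_character (q : nat) (chi : int -> R[i]) : Prop :=
  forall n : int, coprimez n q%:Z -> chi n = 1.

(* N need not be an integer. When it is not, the window may contain an integer
   however small H > 0 is, so an upper bound for a sum over the window that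
   vanishes with H needs N to be an integer or H to be bounded below. *)
Definition int_window (N H : R) : set int := [set n : int | N < n%:~R <= N + H].

(* int_window is finite, so that the finitely supported sum below never takes
   its default value 0 because of an infinite support *)
Lemma finite_int_window (N H : R) : finite_set (int_window N H).
Proof.
set a := Num.floor N.
apply: (@sub_finite_set _ _
  ((fun k : nat => a + k%:Z) @` `I_(absz (Num.floor (N + H) - a)).+1)); last first.
  exact/finite_image/finite_II.
move=> n /= /andP[Nn nNH].
have an : a <= n.
  by rewrite -(ler_int R); apply: le_trans (floor_le N) (ltW Nn).
have nb : n <= Num.floor (N + H) by rewrite floor_ge_int.
exists (absz (n - a)).
  by rewrite /= ltnS -lez_nat !gez0_abs ?subr_ge0 ?lerD2r // (le_trans an).
by rewrite /= gez0_abs ?subr_ge0// subrKC.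
Qed.

Definition mixed_sum (f : {poly R}) (chi : int -> R[i]) (N H : R) : R[i] :=
  \sum_(n \in int_window N H) (e f.[n%:~R] * chi n).

End Characters.

(* Main.v *)
(** The sum over [n] is compared with its shifts by [a b], [A < a <= 2 A],
    [b < B]; the error consists of shorter sums of the same kind, controlled by
    induction on the length.  Since [chi (n + a b) = chi a * chi (n / a + b)]
    and [f (n + a b)] is a quadratic polynomial in [b], Hoelder's inequality
    leaves the [2 r]-th moment over [x mod q] of the sums
    [\sum_b e (alpha b^2 + beta b) chi (x + b)] with arbitrary coefficients.
    The [r]-th power of such a sum is a trigonometric polynomial with at most
    [r^2 B^3] frequencies, so by Cauchy-Schwarz the coefficients can be removed
    at the cost of that factor, and the summation variables get restricted to
    the quadratic Vinogradov system, which has [O(B^(2 r - 3 + eps))] solutions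
    because [2 (z - y) (z - x)] is determined by [x + y - z] and
    [x^2 + y^2 - z^2].

    The complete character sums are bounded by Weil's theorem, proved along the
    lines of Stepanov and Bombieri.  The generating polynomial of the sums of a
    character over monic polynomials factors as [\prod (1 - a_i T)], and the
    power sums of the [a_i] are character sums over the extensions of [F_q].
    Over the extension with [M^2] elements an auxiliary polynomial bounds the
    number of points in each class by [M^2 / (q - 1) + O(M)], which forces
    [|a_i| <= sqrt q]. *)

Require Import Defs.
From HB Require Import structures.
From mathcomp Require Import all_boot all_order all_algebra all_field.
From mathcomp Require Import complex.
From mathcomp Require Import all_classical all_reals all_analysis.
From mathcomp Require Import ring lra zify.

Set Implicit Arguments.
Unset Strict Implicit.
Unset Printing Implicit Defensive.

Import Order.TTheory GRing.Theory Num.Theory.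

Local Open Scope ring_scope.
Local Open Scope complex_scope.

(** * Norms and power sums of complex numbers *)

(** The moment has a diagonal part of order [q B^r], from tuples in which every value is repeated,
    and a part of order [sqrt q B^(2 r - 3)], Weil's bound times the number of solutions of the
    Vinogradov system. They balance at [B^(r - 3) = sqrt q], which explains [r >= 4] and the choice
    of [B] near [q^(1 / (2 (r - 3)))]. The factor [B^3] paid for removing the coefficients is what
    the mean value saves over [B^(2 r)]. The quotients [n / a] modulo [q] are well spread only while
    [A H] stays below [q]; since [A B] is comparable with [H], this means [H^2 < q B] up to
    constants, which is the restriction on [H]. The bound is the [2 r]-th root of
    [H^(2 r - 2) sqrt q B], up to [q^eps].

    On the Weil side the auxiliary polynomial bounds the points of each class from above only. This
    becomes a two-sided estimate because the classes together exhaust the field up to a few points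
    and the values of the character sum to zero. The extensions have even degree, so that their
    order is the square of a power of [q]; the power sums available are then those of the
    [a_i ^ 2]. *)

Section RealNorm.
Variable R : realType.
Implicit Types z w : R[i].

(** The norm of [R[i]] takes values in [R[i]], which is only partially ordered; [nm] moves
    inequalities to the real field. *)
Definition nm z : R := complex.Re `|z|.

Lemma nmE z : `|z| = (nm z)%:C.
Proof. by rewrite /nm normc_def. Qed.

Lemma nm_ge0 z : 0 <= nm z.
Proof. by rewrite -ler0c -nmE. Qed.

Lemma nm0 : nm 0 = 0.
Proof. by apply: complexI; rewrite -nmE normr0. Qed.

Lemma nm1 : nm 1 = 1.
Proof. by apply: complexI; rewrite -nmE normr1. Qed.

Lemma nmN z : nm (- z) = nm z.
Proof. by apply: complexI; rewrite -!nmE normrN. Qed.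

Lemma nmM z w : nm (z * w) = nm z * nm w.
Proof. by apply: complexI; rewrite rmorphM /= -!nmE normrM. Qed.

Lemma nmX z n : nm (z ^+ n) = nm z ^+ n.
Proof. by elim: n => [|n IH]; rewrite ?expr0 ?nm1 // !exprS nmM IH. Qed.

Lemma nm_nat n : nm n%:R = n%:R.
Proof. by apply: complexI; rewrite -nmE normr_nat rmorph_nat. Qed.

Lemma nm_eq0 z : (nm z == 0) = (z == 0).
Proof. by rewrite -(inj_eq (@complexI R)) -nmE normr_eq0. Qed.

Lemma nm_gt0 z : (0 < nm z) = (z != 0).
Proof. by rewrite lt0r nm_ge0 nm_eq0 andbT. Qed.

Lemma nmD z w : nm (z + w) <= nm z + nm w.
Proof. by rewrite -lecR rmorphD /= -!nmE ler_normD. Qed.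

Lemma nm_conj z : nm z^* = nm z.
Proof. by apply: complexI; rewrite -!nmE norm_conjC. Qed.

Lemma nm_sum (I : Type) (r : seq I) (P : pred I) (F : I -> R[i]) :
  nm (\sum_(i <- r | P i) F i) <= \sum_(i <- r | P i) nm (F i).
Proof.
elim/big_rec2: _ => [|i y x _ h]; first by rewrite nm0.
by apply: le_trans (nmD _ _) _; rewrite lerD2l.
Qed.

Lemma nm_prod (I : Type) (r : seq I) (P : pred I) (F : I -> R[i]) :
  nm (\prod_(i <- r | P i) F i) = \prod_(i <- r | P i) nm (F i).
Proof. by rewrite (big_morph nm nmM nm1). Qed.

Lemma mulc_conj z : z * z^* = (nm z ^+ 2)%:C.
Proof. by rewrite -normCK nmE rmorphXn. Qed.

End RealNorm.

Section PowerSums.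
Variable R : realType.

Lemma bernoulli (x : R) n : 1 <= x -> 1 + n%:R * (x - 1) <= x ^+ n.
Proof.
move=> x1; elim: n => [|n IH]; first by rewrite mul0r addr0 expr0.
rewrite exprS -natr1.
have : x * (1 + n%:R * (x - 1)) <= x * x ^+ n by rewrite ler_wpM2l // (le_trans ler01).
apply: le_trans; have : 0 <= n%:R * (x - 1) ^+ 2 by rewrite mulr_ge0 ?sqr_ge0.
nra.
Qed.

(* Evaluating a Lagrange polynomial at the shifted power sums isolates the
   contribution of a single point. *)
Lemma power_sums_bounded (s : seq R[i]) (B K : R) :
  0 < B ->
  (forall n, nm (\sum_(a <- s) a ^+ n.+1) <= K * B ^+ n.+1) ->
  forall a, a \in s -> nm a <= B.
Proof.
move=> B0 hK a as_; rewrite leNgt; apply/negP => Ba.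
pose l := \prod_(c <- rem a (undup s)) ('X - c%:P).
have la : l.[a] != 0.
  rewrite horner_prod prodf_seq_neq0; apply/allP => c /=.
  rewrite mem_rem_uniq ?undup_uniq // inE => /andP[ca _].
  by rewrite !hornerE subr_eq0 eq_sym.
have l0 c : c \in s -> c != a -> l.[c] = 0.
  move=> cs ca; rewrite horner_prod (big_rem c) /= ?hornerE ?subrr ?mul0r //.
  by rewrite mem_rem_uniq ?undup_uniq // inE ca mem_undup.
pose K' := \sum_(t < size l) nm l`_t * (K * B ^+ t).
(* Weighting shifted power sums by the coefficients of [l] leaves only the copies of [a], at a cost
   [K'] independent of [n]. *)
have hn n : nm a ^+ n.+1 * nm l.[a] <= K' * B ^+ n.+1.
  have E : \sum_(t < size l) l`_t * \sum_(c <- s) c ^+ (t + n).+1 =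
           (count_mem a s)%:R * (a ^+ n.+1 * l.[a]).
    under eq_bigr do rewrite big_distrr /=.
    rewrite exchange_big /=.
    transitivity (\sum_(c <- s | c == a) c ^+ n.+1 * l.[c]).
      rewrite [RHS]big_mkcond /=; apply: eq_big_seq => c cs.
      transitivity (c ^+ n.+1 * l.[c]).
        rewrite horner_coef big_distrr /=; apply: eq_bigr => t _.
        by rewrite -addnS exprD; ring.
      by case: eqVneq => // ca; rewrite l0 // mulr0.
    rewrite (eq_bigr (fun=> a ^+ n.+1 * l.[a])); last by move=> c /eqP->.
    by rewrite big_const_seq iter_addr_0 mulr_natl.
  apply: (@le_trans _ _ (nm ((count_mem a s)%:R * (a ^+ n.+1 * l.[a])))).
    rewrite !nmM nm_nat nmX ler_peMl ?mulr_ge0 ?exprn_ge0 ?nm_ge0 //.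
    by rewrite ler1n -has_count has_pred1.
  rewrite -E; apply: le_trans (nm_sum _ _ _) _.
  rewrite /K' big_distrl /=; apply: ler_sum => t _.
  rewrite nmM -mulrA ler_wpM2l ?nm_ge0 //.
  by apply: le_trans (hK _) _; rewrite -addnS exprD mulrA.
set x := nm a / B.
have x1 : 1 < x by rewrite ltr_pdivlMr // mul1r.
pose L := K' / nm l.[a].
have hx n : x ^+ n.+1 <= L.
  rewrite /x /L expr_div_n ler_pdivrMr ?exprn_gt0 // mulrAC.
  by rewrite ler_pdivlMr ?nm_gt0.
(* The powers of [x] stay below [L], but by Bernoulli's inequality they grow at least linearly. *)
have := archi_boundP (normr_ge0 (L / (x - 1))); set n := Num.bound _ => hb.
have : L < n.+1%:R * (x - 1).
  rewrite -ltr_pdivrMr ?subr_gt0 //; apply: le_lt_trans (ler_norm _) _.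
  by apply: lt_trans hb _; rewrite ltr_nat.
have := le_trans (bernoulli n.+1 (ltW x1)) (hx n); lra.
Qed.

End PowerSums.

(** * Newton's identities and reciprocal roots *)

Section Newton.

Lemma coef_1subZX_mul (C : comNzRingType) (a : C) (p : {poly C}) n :
  ((1 - a *: 'X) * p)`_n.+1 = p`_n.+1 - a * p`_n.
Proof. by rewrite mulrBl mul1r coefB -scalerAl coefZ coefXM. Qed.

(** Coefficient comparison in [X L' = - L \sum_k p_k X^k], where [L] is the product and [p_k] the
    power sums; without division it holds over any commutative ring. One factor is added at a time,
    and [A] is what the new element [a] contributes. *)
Lemma newton_identity (C : comNzRingType) (s : seq C) n :
  (\prod_(a <- s) (1 - a *: 'X))`_n.+1 *+ n.+1 =
  - \sum_(k < n.+1) (\sum_(a <- s) a ^+ k.+1) *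
                    (\prod_(a <- s) (1 - a *: 'X))`_(n - k).
Proof.
elim: s n => [|a s IH] n.
  rewrite big_nil coef1 mul0rn big1 ?oppr0 // => k _.
  by rewrite big_nil mul0r.
rewrite big_cons; set L := \prod_(_ <- s) _ in IH *.
pose P k := \sum_(a <- (a :: s)) a ^+ k.+1.
pose A n := \sum_(k < n.+1) a ^+ k.+1 * L`_(n - k).
have G n' : \sum_(k < n'.+1) P k * L`_(n' - k) = A n' - L`_n'.+1 *+ n'.+1.
  rewrite IH opprK -big_split /=; apply: eq_bigr => k _.
  by rewrite /P big_cons mulrDl.
case: n => [|n].
  rewrite coef_1subZX_mul big_ord1 /= subn0 mulr1n.
  have := G 0%N; rewrite big_ord1 /= subn0 mulr1n /A big_ord1 /= /P expr1 subn0.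
  by rewrite mulrBl mul1r coefB -scalerAl coefZ coefXM /= mulr0 subr0 => ->; ring.
have Arec : A n.+1 = a * L`_n.+1 + a * A n.
  rewrite /A big_ord_recl /= subn0 expr1; congr (_ + _).
  rewrite big_distrr /=; apply: eq_bigr => k _.
  by rewrite /bump /= add1n subSS exprS mulrA.
have -> : \sum_(k < n.+2) P k * ((1 - a *: 'X) * L)`_(n.+1 - k) =
   \sum_(k < n.+2) P k * L`_(n.+1 - k) - a * \sum_(k < n.+1) P k * L`_(n - k).
  rewrite big_ord_recr [in RHS]big_ord_recr /= subnn.
  rewrite [X in P n.+1 * X](_ : _ = L`_0); last first.
    by rewrite mulrBl mul1r coefB -scalerAl coefZ coefXM /= mulr0 subr0.
  rewrite big_distrr /= -[RHS]addrAC -sumrB; congr (_ + _).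
  apply: eq_bigr => k _; rewrite subSn -1?ltnS // coef_1subZX_mul; ring.
rewrite !G Arec coef_1subZX_mul; ring.
Qed.

(* The recurrence says that [S k] is the [k.+1]-th coefficient of the
   logarithmic derivative of the generating polynomial of [c]. *)
Lemma log_derivative_power_sums (C : numClosedFieldType) (c S : nat -> C) m :
  c 0%N = 1 ->
  (forall n, c n.+1 *+ n.+1 = \sum_(k < n.+1) S k * c (n - k)%N) ->
  (forall n, (m < n)%N -> c n = 0) ->
  exists2 s : seq C, (size s <= m)%N &
    forall k, S k = - \sum_(a <- s) a ^+ k.+1.
Proof.
move=> c0 crec cm.
pose p := \poly_(i < m.+1) c i.
have pE n : p`_n = c n.
  by rewrite coef_poly; case: ltnP => // h; rewrite cm.
have p0 : p.[0] = 1 by rewrite horner_coef0 pE.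
have [r Hp] := closed_field_poly_normal p.
have pn0 : p != 0 by apply/eqP => h; move: p0; rewrite h horner0 => /esym/eqP; rewrite oner_eq0.
have rn0 z : z \in r -> z != 0.
  move=> zr; apply/eqP => z0; move: p0; rewrite Hp hornerZ horner_prod.
  by rewrite (big_rem z) //= z0 hornerXsubC subrr mul0r mulr0 => /esym/eqP; rewrite oner_eq0.
(* As [p.[0] = 1], no root is zero and [p] is the product of the [1 - z^-1 X]. *)
pose s := [seq z^-1 | z <- r].
have Es : p = \prod_(a <- s) (1 - a *: 'X).
  have [k Hk] : exists k, p = k *: \prod_(a <- s) (1 - a *: 'X).
    rewrite Hp; move: (lead_coef p) => l.
    elim: r rn0 {Hp} @s l => [|z r IH] rn0 /= l; first by exists l; rewrite !big_nil.
    have [|k Hk] := IH _ (l * - z).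
      by move=> y yr; apply: rn0; rewrite inE yr orbT.
    exists k; rewrite !big_cons [RHS]scalerAr -Hk -[RHS]scalerAr -scalerA.
    rewrite [X in _ = _ *: X]scalerAl; congr (_ *: (_ * _)).
    by rewrite scalerBr scalerA mulNr mulfV ?rn0 ?mem_head // scaleN1r opprK -alg_polyC scaleNr addrC.
  have : p.[0] = k.
    rewrite Hk hornerZ horner_prod big1_seq ?mulr1 // => a _.
    by rewrite !hornerE ?mulr0 ?subr0.
  by rewrite p0 => k1; rewrite Hk -k1 scale1r.
exists s.
  rewrite size_map -ltnS -(size_prod_XsubC r id) -(size_scale _ (_ : lead_coef p != 0)) ?lead_coef_eq0 //.
  by rewrite -Hp size_poly.
have nw n := newton_identity s n.
(* In both recurrences the last power sum has coefficient [c 0 = 1], so they determine the power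
   sums one after the other. *)
move=> k; elim/ltn_ind: k => k IH.
have := nw k; have := crec k; rewrite -Es pE => ->.
rewrite -sumrN big_ord_recr [in RHS]big_ord_recr /= subnn pE c0 !mulr1.
rewrite (eq_bigr (fun i : 'I_k => - ((\sum_(a <- s) a ^+ i.+1) * p`_(k - i)))); last first.
  by move=> i _; rewrite IH // pE mulNr.
by move/addrI.
Qed.

End Newton.

(** * Euler products over a finite field *)

Section Monics.
Variable F : finFieldType.
Implicit Types P g : {poly F}.

Definition monics n : seq {poly F} :=
  [seq 'X^n + rVpoly v | v <- enum {: 'rV[F]_n}].

Lemma mem_monics n g : (g \in monics n) = (g \is monic) && (size g == n.+1).
Proof.
apply/mapP/andP => [[v _ ->]|[gm /eqP sg]].
  have sv : (size (rVpoly v) < size ('X^n : {poly F}))%N.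
    by rewrite size_polyXn ltnS size_poly.
  by rewrite monicE lead_coefDl // lead_coefXn size_polyDl // size_polyXn.
exists (poly_rV (g - 'X^n)); first by rewrite mem_enum.
suff sz : (size (g - 'X^n)%R <= n)%N by rewrite (poly_rV_K sz) addrC subrK.
apply/leq_sizeP => j; rewrite leq_eqVlt coefB coefXn => /orP[/eqP<-|nj].
  rewrite eqxx; move: gm; rewrite monicE lead_coefE sg /= => /eqP->.
  by rewrite subrr.
by rewrite nth_default ?sg // gtn_eqF // subr0.
Qed.

Lemma monics_uniq n : uniq (monics n).
Proof.
rewrite map_inj_uniq ?enum_uniq // => v w /addrI.
exact: (can_inj (@rVpolyK _ _)).
Qed.

(** The change of variable [g = P * h] in sums over monic multiples of [P]. *)
Lemma perm_dvdp_monics P e n : P \in monics e -> (e <= n)%N ->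
  perm_eq [seq g <- monics n | P %| g] [seq P * g | g <- monics (n - e)].
Proof.
rewrite mem_monics => /andP[Pm /eqP sP] en.
have P0 : P != 0 by rewrite monic_neq0.
apply: uniq_perm; first by rewrite filter_uniq ?monics_uniq.
  by rewrite map_inj_uniq ?monics_uniq //; apply: mulfI.
move=> g; rewrite mem_filter mem_monics; apply/andP/mapP => [[dvd /andP[gm /eqP sg]]|].
  have E : g = P * (g %/ P) by rewrite mulrC divpK.
  exists (g %/ P) => //; rewrite mem_monics.
  move: gm sg; rewrite {1 2}E monicMl // => qm; rewrite qm size_monicM ?monic_neq0 // sP /=.
  move=> h; apply/eqP; lia.
move=> [q]; rewrite mem_monics => /andP[qm /eqP sq] ->.
rewrite dvdp_mulr // monicMl // qm size_monicM ?monic_neq0 // sP sq /=; split=> //; apply/eqP; lia.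
Qed.

Definition irrs n : seq {poly F} :=
  [seq P <- monics n | `[< irreducible_poly P >]].

Lemma mem_irrs n P :
  reflect [/\ irreducible_poly P, P \is monic & size P = n.+1] (P \in irrs n).
Proof.
rewrite mem_filter mem_monics.
apply: (iffP and3P) => [[/asboolP ? ? /eqP ?]|[? ? ->]]; split=> //.
exact/asboolP.
Qed.

Lemma irrs_uniq n : uniq (irrs n).
Proof. by rewrite filter_uniq ?monics_uniq. Qed.

Lemma irreducible_divisor g : (1 < size g)%N ->
  exists P, [/\ irreducible_poly P, P \is monic & P %| g].
Proof.
have [n] := ubnP (size g); elim: n g => // n IH g sgn sg.
have g0 : g != 0 by rewrite -size_poly_gt0 ltnW.
have [irr|nirr] := pselect (irreducible_poly g).
  have l0 : (lead_coef g)^-1 != 0 by rewrite invr_eq0 lead_coef_eq0.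
  exists ((lead_coef g)^-1 *: g); split.
  - split=> [|q sq]; first by rewrite size_scale.
    rewrite dvdpZr // => qg; apply: eqp_trans (irr.2 q sq qg) _.
    by rewrite eqp_sym eqp_scale.
  - by rewrite monicE lead_coefZ mulVf // lead_coef_eq0.
  - by rewrite dvdpZl.
have [q [sq qg nq]] : exists q : {poly F}, [/\ size q != 1%N, q %| g & ~~ (q %= g)].
  apply: contra_notP nirr => h; split=> // q sq qg.
  by apply: contra_notT h => nq; exists q.
have q0 : q != 0 by apply: contraNneq g0 => e; move: qg; rewrite e dvd0p.
have sqg : (size q < size g)%N.
  rewrite ltn_neqAle dvdp_leq // andbT.
  by rewrite dvdp_size_eqp.
have [||P [? ? Pq]] := IH q; first exact: leq_trans sqg sgn.
  by move: q0 sq; rewrite -size_poly_gt0; case: (size q) => [|[]].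
by exists P; split=> //; apply: dvdp_trans Pq qg.
Qed.

Lemma irreducible_monic_coprime P Q : irreducible_poly P -> irreducible_poly Q ->
  P \is monic -> Q \is monic -> P != Q -> coprimep P Q.
Proof.
move=> iP iQ Pm Qm; apply: contraNT => nc.
rewrite -eqp_monic //.
have h1 := iP.2 _ nc (dvdp_gcdl _ _); have h2 := iQ.2 _ nc (dvdp_gcdr _ _).
by rewrite eqp_sym in h1; apply: eqp_trans h1 h2.
Qed.

(** The polynomial analogue of writing [log n] as the sum of the von Mangoldt function over the
    divisors of [n]. One irreducible factor [P0] is split off; by coprimality this does not affect
    the powers of the other [P]. The cutoff [m] is separate from the degree so that it stays fixed
    in the induction. *)
Lemma degree_sum_irreducible m n g : g \in monics n -> (n <= m)%N ->
  (\sum_(1 <= e < m.+1) \sum_(P <- irrs e) \sum_(1 <= j < m.+1)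
     e * (P ^+ j %| g)%R = n)%N.
Proof.
elim/ltn_ind: n g => -[|n] IH g; rewrite mem_monics => /andP[gm /eqP sg] nm.
  rewrite big_nat big1 // => e he.
  rewrite big_seq big1 // => P /mem_irrs[_ _ sP].
  rewrite big_nat big1 // => j /andP[j0 _].
  case: (boolP (P ^+ j %| g)) => [h|]; last by rewrite muln0.
  have : P %| g by apply: dvdp_trans h; rewrite -(prednK j0) exprS dvdp_mulr.
  have -> : g = 1.
    by apply/eqP; rewrite -eqp_monic ?monic1 // -size_poly_eq1 sg.
  by rewrite dvdp1 sP; case: e he {sP}.
have [|P0 [iP0 P0m P0g]] := irreducible_divisor (_ : 1 < size g)%N; first by rewrite sg.
have P0n0 : P0 != 0 by rewrite monic_neq0.
have [e0 sP0] : exists e0, size P0 = e0.+2 by have := iP0.1; case: (size P0) => [|[|z]] // _; exists z.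
pose g1 := g %/ P0.
have gE : g = g1 * P0 by rewrite divpK.
have g1m : g1 \is monic by move: gm; rewrite gE mulrC monicMl.
have sg1 : size g1 = (n - e0).+1 /\ (e0 <= n)%N.
  have := sg; rewrite gE size_Mmonic ?monic_neq0 // sP0.
  have : (0 < size g1)%N by rewrite size_poly_gt0 monic_neq0.
  by move: (size g1) => z z0 z1; split; lia.
case: sg1 => sg1 e0n.
have IH1 : _ := IH (n - e0)%N _ g1 _ _.
rewrite -{}[RHS](_ : e0.+1 + (n - e0) = n.+1)%N; last by lia.
rewrite -[in RHS]IH1 ?mem_monics ?g1m ?sg1 //; [|lia..].
have -> : (e0.+1 = \sum_(1 <= e < m.+1) \sum_(P <- irrs e) (if P == P0 then e else 0))%N.
  transitivity (\sum_(1 <= e < m.+1 | e == e0.+1) e)%N.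
    by rewrite big_nat1_eq ifT //; lia.
  rewrite big_mkcond /=; apply: eq_bigr => e _.
  rewrite -big_mkcond big_const_seq iter_addn_0.
  rewrite count_uniq_mem ?irrs_uniq //.
  case: mem_irrs => [[_ _]|h]; first by rewrite sP0 => -[<-]; rewrite eqxx muln1.
  rewrite muln0 ifN //; apply/eqP => e1; apply: h; split=> //; by rewrite sP0 e1.
rewrite -big_split /=; apply: eq_bigr => e _.
rewrite -big_split /=; rewrite big_seq [RHS]big_seq; apply: eq_bigr => P /mem_irrs[iP Pm sP].
case: eqVneq => [PE|PP0].
  rewrite {P iP Pm}PE in sP *.
  have e1 : (1 <= e)%N by move: sP; rewrite sP0; case: e.
  (* Dividing by [P0] lowers [j] by one: the sum gains the term [j = 0], equal to [e], and loses
     [j = m], where [P0 ^+ m] is too large to divide [g1]. *)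
  pose G j := (e * (P0 ^+ j %| g1)%R)%N.
  have GE j : (e * (P0 ^+ j.+1 %| g)%R = G j)%N by rewrite gE exprSr dvdp_mul2r.
  have Gm : G m = 0%N.
    rewrite /G; case: (boolP (_ %| _)) => [h|]; last by rewrite muln0.
    have := dvdp_leq (monic_neq0 g1m) h; have := size_exp P0 m; rewrite sP0 sg1 /=.
    by rewrite mulSn; move: (size _) (e0 * m)%N => z t; lia.
  have G0 : G 0%N = e by rewrite /G expr0 dvd1p muln1.
  rewrite big_add1 /= (eq_bigr G) // [in RHS]big_add1 /=.
  rewrite -[X in (X + _)%N]G0 -big_nat_recl // big_nat_recr //= Gm addn0 //.
by rewrite add0n; apply: eq_bigr => j _; rewrite gE Gauss_dvdpl // coprimep_expl // irreducible_monic_coprime.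
Qed.

Section EulerProduct.
Variables (C : comNzRingType) (Lam : {poly F} -> C).
Hypotheses (Lam1 : Lam 1 = 1) (LamM : forall g h, Lam (g * h) = Lam g * Lam h).

(** The coefficient of [T^n] in the L-function of [Lam]. *)
Definition csum n := \sum_(g <- monics n) Lam g.

(** The coefficient of [T^k] in [T L' / L], computed from the Euler product; [n] truncates both the
    degrees and the exponents. *)
Definition ssum_bounded n k :=
  \sum_(1 <= e < n.+1) \sum_(P <- irrs e) \sum_(1 <= j < n.+1 | (j * e == k)%N)
     Lam P ^+ j *+ e.

Definition ssum k := ssum_bounded k k.

Lemma LamX g j : Lam (g ^+ j) = Lam g ^+ j.
Proof. by elim: j => [|j IH]; rewrite ?expr0 // !exprS LamM IH. Qed.

Lemma csum0 : csum 0 = 1.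
Proof.
rewrite /csum (_ : monics 0 = [:: 1]) ?big_seq1 //.
apply: perm_small_eq => //.
apply: uniq_perm => //; first exact: monics_uniq.
move=> g; rewrite mem_monics inE; apply/andP/eqP => [[gm /eqP sg]|->].
  by apply/eqP; rewrite -eqp_monic ?monic1 // -size_poly_eq1 sg.
by rewrite monic1 size_poly1.
Qed.

(** In [j * e = k] both factors are at most [k], so a longer truncation adds nothing. A common
    truncation is what allows the sums to be exchanged in [csum_recurrence]. *)
Lemma ssum_boundedE n k : (0 < k)%N -> (k <= n)%N -> ssum_bounded n k = ssum k.
Proof.
move=> k0 kn; rewrite /ssum /ssum_bounded.
rewrite (big_cat_nat (n := k.+1)) //= [X in _ + X]big_nat [X in _ + X]big1 ?addr0; last first.
  move=> e /andP[ke _]; rewrite big1 // => P _; rewrite big_nat_cond big1 // => j.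
  by move=> /andP[/andP[j0 _] /eqP h]; exfalso; nia.
rewrite big_nat [RHS]big_nat; apply: eq_bigr => e /andP[e0 _]; apply: eq_bigr => P _.
rewrite (big_cat_nat (n := k.+1)) //= [X in _ + X]big_nat_cond [X in _ + X]big1 ?addr0 //.
by move=> j /andP[/andP[j0 _] /eqP h]; exfalso; nia.
Qed.

(** The factor [n.+1] is the degree of each [g]; it is expanded over the prime powers [P ^+ j]
    dividing [g], and writing [g = P ^+ j * h] produces the convolution. *)
Lemma csum_recurrence n :
  csum n.+1 *+ n.+1 = \sum_(k < n.+1) ssum k.+1 * csum (n - k).
Proof.
have -> : \sum_(k < n.+1) ssum k.+1 * csum (n - k) =
          \sum_(1 <= k < n.+2) ssum_bounded n.+1 k * csum (n.+1 - k).
  rewrite big_add1 /= big_mkord; apply: eq_bigr => k _.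
  by rewrite ssum_boundedE // subSS.
transitivity (\sum_(1 <= e < n.+2) \sum_(P <- irrs e) \sum_(1 <= j < n.+2)
   (if (j * e <= n.+1)%N then (Lam P ^+ j * csum (n.+1 - j * e)) *+ e else 0)).
  transitivity (\sum_(g <- monics n.+1) \sum_(1 <= e < n.+2) \sum_(P <- irrs e)
     \sum_(1 <= j < n.+2) Lam g *+ (e * (P ^+ j %| g)%R)%N).
    rewrite /csum -sumrMnl big_seq [RHS]big_seq; apply: eq_bigr => g gm.
    rewrite -[in LHS](degree_sum_irreducible gm (leqnn _)).
    rewrite -sumrMnr; apply: eq_bigr => e _.
    by rewrite -sumrMnr; apply: eq_bigr => P _; rewrite -sumrMnr.
  rewrite exchange_big /= big_nat [RHS]big_nat; apply: eq_bigr => e /andP[e1 _].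
  rewrite exchange_big /= big_seq [RHS]big_seq; apply: eq_bigr => P /mem_irrs[_ Pm sP].
  rewrite exchange_big /= big_nat [RHS]big_nat; apply: eq_bigr => j /andP[j1 _].
  have Pj : P ^+ j \in monics (j * e).
    rewrite mem_monics monic_exp // -(prednK (_ : 0 < size (P ^+ j)))%N; last first.
      by rewrite size_poly_gt0 expf_neq0 // monic_neq0.
    by rewrite size_exp sP /= mulnC.
  under eq_bigr do rewrite mulrnA mulrb.
  rewrite -big_mkcond /= -big_filter.
  case: leqP => je.
    rewrite (perm_big _ (perm_dvdp_monics Pj je)) big_map /= /csum.
    by rewrite big_distrr /= -sumrMnl; apply: eq_bigr => g _; rewrite LamM LamX.
  rewrite big_filter big_seq_cond big1 // => g; rewrite mem_monics => /andP[/andP[gm /eqP sg] dv].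
  have := dvdp_leq (monic_neq0 gm) dv; move: Pj; rewrite mem_monics => /andP[_ /eqP->].
  by rewrite sg; lia.
have E k : ssum_bounded n.+1 k * csum (n.+1 - k) =
  \sum_(1 <= e < n.+2) \sum_(P <- irrs e) \sum_(1 <= j < n.+2)
   (if (j * e == k)%N then (Lam P ^+ j * csum (n.+1 - k)) *+ e else 0).
  rewrite /ssum_bounded big_distrl /=; apply: eq_bigr => e _.
  rewrite big_distrl /=; apply: eq_bigr => P _.
  rewrite big_distrl /= big_mkcond; apply: eq_bigr => j _.
  by case: ifP => // _; rewrite mulrnAl.
under [RHS]eq_bigr do rewrite E.
rewrite [RHS]exchange_big /= big_nat [RHS]big_nat; apply: eq_bigr => e /andP[e1 _].
rewrite [RHS]exchange_big /=; apply: eq_bigr => P _.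
rewrite [RHS]exchange_big /= big_nat [RHS]big_nat; apply: eq_bigr => j /andP[j1 _].
rewrite -[RHS]big_mkcond /=.
under [RHS]eq_bigl do rewrite eq_sym.
by rewrite big_nat1_eq muln_gt0 j1 e1 ltnS.
Qed.

End EulerProduct.
End Monics.

(** * The Stepanov-Bombieri auxiliary polynomial *)

Section Stepanov.

(** The matrix of coefficients has more rows than columns, hence a nonzero left kernel. *)
Lemma poly_linear_dependence (K : fieldType) (T : finType) (p : T -> {poly K}) D :
  (forall t, size (p t) <= D)%N -> (D < #|T|)%N ->
  exists2 n : T -> K, (exists t, n t != 0) & \sum_t n t *: p t = 0.
Proof.
move=> hs hD.
pose A : 'M[K]_(#|T|, D) := \matrix_i poly_rV (p (enum_val i)).
have : kermx A != 0.
  rewrite kermx_eq0 /row_free; apply: contraTneq (rank_leq_col A) => ->.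
  by rewrite -ltnNge.
case/rowV0Pn => v /sub_kermxP vA vn0.
exists (fun t => v 0 (enum_rank t)).
  case/rV0Pn: vn0 => i hi; exists (enum_val i); by rewrite enum_valK.
rewrite (reindex (@enum_val T T)) /=; last exact/onW_bij/enum_val_bij.
have := congr1 rVpoly vA; rewrite mulmx_sum_row !linear_sum /= linear0 => vA0.
rewrite -[RHS]vA0; apply: eq_bigr => i _; rewrite enum_valK linearZ /= rowK poly_rV_K //.
Qed.

(** Among the terms with nonzero coefficient, the one of least order at [0] cannot be cancelled. *)
Lemma poly_valuation_independence (K : fieldType) (T : finType) (v : T -> nat)
    (g : T -> {poly K}) (n : T -> K) :
  injective v -> (forall t, (g t).[0] != 0) -> (exists t, n t != 0) ->
  \sum_t n t *: ('X^(v t) * g t) != 0.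
Proof.
move=> vI g0 [t1 nt1].
case: (@arg_minnP _ t1 (fun t => n t != 0) v nt1) => t0 nt0 hmin.
apply/eqP => /(congr1 (fun p : {poly K} => p`_(v t0))).
rewrite coef0 coef_sum (bigD1 t0) //= big1 => [|t tt0].
  rewrite addr0 coefZ coefXnM ltnn subnn -horner_coef0 => /eqP.
  by rewrite mulf_eq0 (negbTE nt0) (negbTE (g0 _)).
rewrite coefZ; have [->|nt] := eqVneq (n t) 0; first by rewrite mul0r.
rewrite coefXnM ltn_neqAle hmin // andbT (inj_eq vI) eq_sym tt0 mulr0 //.
Qed.

Lemma expr_sum_pchar (K : comNzRingType) p s (pK : p \in [pchar K])
    (I : Type) (r : seq I) (F : I -> K) :
  (\sum_(i <- r) F i) ^+ (p ^ s) = \sum_(i <- r) F i ^+ (p ^ s).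
Proof.
have pn : [pchar K].-nat (p ^ s)%N.
  rewrite pnatX; apply/orP; left.
  by rewrite pnatE // ?(pcharf_prime pK).
have p0 : p != 0%N by rewrite -lt0n prime_gt0 // (pcharf_prime pK).
elim: r => [|i r IH]; first by rewrite !big_nil expr0n expn_eq0 (negbTE p0).
by rewrite !big_cons exprDn_pchar // IH.
Qed.

Lemma size_exp_leqS (K : nzRingType) (p : {poly K}) m n :
  (size p <= m.+1)%N -> (size (p ^+ n) <= (m * n).+1)%N.
Proof.
move=> h; apply: leq_trans (size_poly_exp_leq _ _) _.
by rewrite ltnS leq_mul2r; apply/orP; right; case: (size p) h.
Qed.

(* Points with [f ^+ ((Q - 1) / d) = w], [Q = M ^ 2], are zeros of [rho]
   because raising to the [M]-th power turns [rho] into the relation [phi = 0]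
   there; [rho] is nonzero since its terms have distinct orders at [0]. *)
Lemma stepanov_bound (K : finFieldType) p s M d u m (f1 : {poly K}) (w : K) :
  p \in [pchar K] -> M = (p ^ s)%N -> #|K| = (M ^ 2)%N -> M = (d * u).+1 ->
  (0 < d)%N -> (0 < u)%N -> (2 < M)%N -> f1.[0] != 0 -> (size f1 <= m)%N -> w != 0 ->
  (#|[pred x | ('X * f1).[x] ^+ (u * M.+1) == w]| <= M * u + M * (4 * m + 12))%N.
Proof.
move=> pK Ms KM Mdu d0 u0 M2 f10 sf1 w0.
pose h := ('X * f1) ^+ u.
pose h1 := f1 ^+ u.
have hE : h = 'X^u * h1 by rewrite /h exprMn.
have h10 : h1.[0] != 0 by rewrite horner_exp expf_neq0.
have sh n : (size (h ^+ n) <= (m * u * n).+1)%N.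
  apply: size_exp_leqS; apply: size_exp_leqS.
  by apply: leq_trans (size_polyMleq _ _) _; rewrite size_polyX /=.
have hX x : h.[x] = ('X * f1).[x] ^+ u by rewrite /h horner_exp.
clearbody h h1.
(* Large enough for the [I * (M - 1)] unknowns to outnumber the [M * u + I + m * M] coefficients of
   the relation, as checked in [cT]. *)
pose I := (u + 3 * m + 10)%N.
pose T := ('I_I * 'I_d * 'I_u)%type.
(* The image of a term of [rho] under the [M]-th power: [x ^+ (M ^ 2) = x] shortens the exponent of
   [x], and [h ^+ M.+1 = w] turns [h ^+ (M * j)] into [w ^+ j] over [h ^+ j]. The denominators are
   cleared by [h ^+ d.-1]. *)
pose P (t : T) := 'X^(M * t.2 + t.1.1) * h ^+ (d.-1 - t.1.2).
have PD : forall t : T, (size (w ^+ t.1.2 *: P t)%R <= M * u + I + m * M)%N.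
  move=> [[i j] k] /=.
  apply: leq_trans (size_scale_leq _ _) _.
  apply: leq_trans (size_polyMleq _ _) _; rewrite size_polyXn /=.
  have := sh (d.-1 - j)%N; have := ltn_ord i; have := ltn_ord k; have := ltn_ord j.
  move: (size _) => z hj hk hi hz.
  have e1 : (M * k + M <= M * u)%N by rewrite -mulnSr leq_mul2l hk orbT.
  have e2 : (m * u * (d.-1 - j) <= m * (u * d))%N.
    by rewrite -mulnA leq_mul2l leq_mul2l; apply/orP; right; apply/orP; right; lia.
  have e3 : (m * (u * d) <= m * M)%N by rewrite leq_mul2l Mdu mulnC leqnSn orbT.
  lia.
have cT : (M * u + I + m * M < #|{: T}|)%N.
  rewrite !card_prod !card_ord -mulnA.
  have -> : (d * u = M.-1)%N by rewrite Mdu.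
  have uM : (u < M)%N by rewrite Mdu ltnS; case: d d0 {Mdu T P PD} => // d' _; rewrite mulSn leq_addr.
  rewrite /I; nia.
have [n' [t0 nt0] Hn'] := poly_linear_dependence PD cT.
have M0 : (0 < M)%N by lia.
have KQ (x : K) : x ^+ M ^+ M = x by rewrite -exprM mulnn -KM expf_card.
(* By [KQ] the [M]-th power of [n t] is [n' t], the coefficient in the relation. *)
pose n t := n' t ^+ M.
have nn0 : exists t, n t != 0 by exists t0; rewrite expf_neq0.
(* The order at [0] of a term of [rho], as [h] has order [u]. It is injective as a mixed-radix
   expansion: [k < u] and [k + u * j < M]. *)
pose v (t : T) := (t.2 + M * t.1.1 + u * t.1.2)%N.
have vI : injective v.
  move=> [[i j] k] [[i' j'] k']; rewrite /v /= => e.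
  have b (jj : 'I_d) (kk : 'I_u) : (kk + u * jj < M)%N.
    rewrite Mdu ltnS; have := ltn_ord jj; have := ltn_ord kk => hk hj.
    have : (u * jj + u <= d * u)%N by rewrite -mulnSr mulnC leq_mul2r hj orbT.
    lia.
  have e1 : (i * M + (k + u * j) = i' * M + (k' + u * j'))%N by rewrite (mulnC i) (mulnC i'); lia.
  have ei : i = i' :> nat.
    by have := congr1 (divn^~ M) e1; rewrite !divnMDl // !divn_small ?b // !addn0.
  have e2 : (j * u + k = j' * u + k')%N by rewrite (mulnC j) (mulnC j'); rewrite ei in e1; lia.
  have ej : j = j' :> nat.
    by have := congr1 (divn^~ u) e2; rewrite !divnMDl // !divn_small // !addn0.
  have ek : k = k' :> nat by rewrite ej in e2; lia.
  by rewrite (val_inj ei) (val_inj ej) (val_inj ek).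
pose rho := \sum_t n t *: ('X^(t.2 + M * t.1.1) * h ^+ t.1.2 : {poly K}).
have rho0 : rho != 0.
  have := @poly_valuation_independence K T v (fun t => h1 ^+ t.1.2) n vI _ nn0.
  rewrite (_ : \sum_t _ = rho); first by apply=> t; rewrite horner_exp expf_neq0.
  apply: eq_bigr => t _; congr (_ *: _).
  by rewrite hE exprMn -['X^u ^+ _]exprM mulrA -exprD.
have srho : (size rho <= u + M * I + m * M)%N.
  apply: (big_ind (fun q : {poly K} => size q <= u + M * I + m * M)%N).
  - by rewrite size_poly0.
  - by move=> a b ha hb; apply: leq_trans (size_polyD _ _) _; rewrite geq_max ha hb.
  move=> [[i j] k] _ /=; apply: leq_trans (size_scale_leq _ _) _.
  apply: leq_trans (size_polyMleq _ _) _; rewrite size_polyXn /=.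
  have := sh j; have := ltn_ord i; have := ltn_ord k; have := ltn_ord j.
  move: (size _) => z hj hk hi hz.
  have e1 : (M * i + M <= M * I)%N by rewrite -mulnSr leq_mul2l hi orbT.
  have e2 : (m * u * j <= m * (u * d))%N.
    by rewrite -mulnA leq_mul2l leq_mul2l; apply/orP; right; apply/orP; right; lia.
  have e3 : (m * (u * d) <= m * M)%N by rewrite leq_mul2l Mdu mulnC leqnSn orbT.
  lia.
have rt x : ('X * f1).[x] ^+ (u * M.+1) == w -> root rho x.
  move=> /eqP hx.
  have hxE : h.[x] ^+ M.+1 = w by rewrite hX -exprM.
  have hx0 : h.[x] != 0 by apply: contraNneq w0 => e; rewrite -hxE e expr0n.
  have rM : rho.[x] ^+ M = \sum_t n' t * (x ^+ (M * t.2 + t.1.1) * h.[x] ^+ (M * t.1.2)).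
    rewrite horner_sum Ms (expr_sum_pchar _ pK) -Ms; apply: eq_bigr => t _.
    rewrite hornerZ hornerM hornerXn horner_exp !exprMn KQ; congr (_ * (_ * _)).
      rewrite -exprM mulnDl !exprD (mulnC _ M); congr (_ * _).
      by rewrite mulnAC !exprM KQ.
    by rewrite -exprM mulnC.
  have : h.[x] ^+ d.-1 * rho.[x] ^+ M = 0.
    rewrite rM big_distrr /=.
    transitivity (\sum_t n' t *: (w ^+ t.1.2 *: P t)).[x]; last by rewrite Hn' horner0.
    rewrite horner_sum; apply: eq_bigr => -[[i j] k] _ /=.
    rewrite /P !hornerZ hornerM hornerXn horner_exp /= -hxE -exprM mulSn (exprD h.[x]).
    have -> : h.[x] ^+ d.-1 = h.[x] ^+ (d.-1 - j) * h.[x] ^+ j.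
      by rewrite -exprD subnK // -ltnS prednK.
    ring.
  move/eqP; rewrite mulf_eq0 !expf_eq0 (negbTE hx0) andbF /= => /andP[_ h0]; exact: h0.
have := max_poly_roots rho0 (_ : all (root rho) (enum [pred x | ('X * f1).[x] ^+ (u * M.+1) == w])) (enum_uniq _).
rewrite -cardE => -/(_ _)hh.
have {}hh : (#|[pred x | ('X * f1).[x] ^+ (u * M.+1) == w]| < size rho)%N.
  by apply: hh; apply/allP => x; rewrite mem_enum inE => /rt.
have uM : (u < M)%N by rewrite Mdu ltnS; case: (d) d0 => // d' _; rewrite mulSn leq_addr.
apply: leq_trans (ltnW hh) _; apply: leq_trans srho _; rewrite /I !mulnDr; nia.
Qed.

End Stepanov.

(** * Character sums over extensions *)

Section FrobeniusOrbits.
Variables (F K : finFieldType) (emb : {rmorphism F -> K}) (p k : nat).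
Hypotheses (pK : p \in [pchar K]) (cardF : #|F| = p) (cardK : #|K| = (p ^ k)%N).
Hypothesis k_gt0 : (0 < k)%N.
Local Notation "P ^i" := (map_poly emb P) (at level 2, format "P ^i").
Let frob : {rmorphism K -> K} := pFrobenius_aut pK.

Let frobE x : frob x = x ^+ p.
Proof. exact: pFrobenius_autE. Qed.

Let p_prime : prime p := pcharf_prime pK.

Lemma exprB_pchar_pow (x y : K) i :
  (x - y) ^+ (p ^ i) = x ^+ (p ^ i) - y ^+ (p ^ i).
Proof.
elim: i x y => [|i IH] x y; first by rewrite expn0 !expr1.
by rewrite expnSr !exprM IH -!frobE rmorphB.
Qed.

Lemma expr_pchar_pow_inj i : injective (fun x : K => x ^+ (p ^ i)).
Proof.
move=> x y /eqP; rewrite -subr_eq0 -exprB_pchar_pow expf_eq0 subr_eq0.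
by case/andP => _ /eqP.
Qed.

Lemma emb_pow_card i (a : F) : emb a ^+ (p ^ i) = emb a.
Proof.
elim: i => [|i IH]; first by rewrite expn0 expr1.
by rewrite expnSr exprM IH -rmorphXn -cardF expf_card.
Qed.

(** The [p] images of elements of [F] already exhaust the roots of ['X^p - 'X]. *)
Lemma frobenius_fixed (x : K) : x ^+ p = x -> exists a, x = emb a.
Proof.
move=> xp; apply: contrapT => nx.
pose rs := x :: codom emb.
have ur : uniq rs.
  rewrite /= map_inj_uniq ?enum_uniq ?andbT; last exact: fmorph_inj.
  by apply/negP => /codomP[a xa]; apply: nx; exists a.
have p1 := prime_gt1 p_prime.
have sz : size ('X^p - 'X : {poly K}) = p.+1.
  by rewrite size_polyDl ?size_polyN ?size_polyXn ?size_polyX.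
have n0 : 'X^p - 'X != 0 :> {poly K} by rewrite -size_poly_eq0 sz.
suff ar : all (root ('X^p - 'X)) rs.
  by have := max_poly_roots n0 ar ur; rewrite sz /= size_codom cardF ltnn.
apply/allP => y.
rewrite inE /root !hornerE subr_eq0 => /orP[/eqP->|/codomP[a ->]]; first by rewrite xp.
by rewrite -[X in _ ^+ X]expn1 emb_pow_card.
Qed.

Lemma frobenius_fixed_poly (g : {poly K}) :
  map_poly frob g = g -> exists g0, g = g0 ^i.
Proof.
move=> gf.
have h i : exists a, g`_i = emb a.
  apply: frobenius_fixed; rewrite -frobE -coef_map gf //.
have [c hc] := choice h.
exists (\poly_(i < size g) c i); apply/polyP => i.
rewrite coef_map coef_poly; case: ltnP => // hi.
by rewrite nth_default //; symmetry; apply: rmorph0.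
Qed.

Lemma root_frobenius (P : {poly F}) x i : root P^i x -> root P^i (x ^+ (p ^ i)).
Proof.
elim: i => [|i IH] hx; first by rewrite expn0 expr1.
rewrite expnSr exprM -frobE.
have -> : P^i = map_poly frob P^i.
  by apply/polyP => j; rewrite !coef_map /= frobE -[X in _ ^+ X]expn1 emb_pow_card.
by rewrite fmorph_root IH.
Qed.

(** For [e] the degree of [x] over [F], the minimal polynomial of [x]. *)
Definition conj_poly (x : K) e := \prod_(i < e) ('X - (x ^+ (p ^ i))%:P).

Lemma conj_poly_frob x e : (0 < e)%N -> x ^+ (p ^ e) = x ->
  map_poly frob (conj_poly x e) = conj_poly x e.
Proof.
case: e => // e _ xe; rewrite rmorph_prod /= /conj_poly.
rewrite (eq_bigr (fun i : 'I_e.+1 => 'X - (x ^+ (p ^ i.+1))%:P)); last first.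
  by move=> i _; rewrite map_polyXsubC frobE -exprM -expnSr.
by rewrite big_ord_recr big_ord_recl /= xe expn0 expr1 mulrC.
Qed.

Lemma not_coprime_root (P Q : {poly F}) x :
  root P^i x -> root Q^i x -> ~~ coprimep P Q.
Proof.
move=> hP hQ; apply/negP; rewrite -(coprimep_map emb) => /coprimep_root /(_ hP).
by move: hQ; rewrite /root => ->.
Qed.

Lemma irreducible_dvd_root (P Q : {poly F}) x : irreducible_poly P ->
  root P^i x -> root Q^i x -> P %| Q.
Proof.
move=> iP hP hQ; have nc := not_coprime_root hP hQ.
have := iP.2 _ nc (dvdp_gcdl _ _); rewrite /eqp => /andP[_ h].
exact: dvdp_trans h (dvdp_gcdr _ _).
Qed.

(** With [e'] the least period of [x] under Frobenius, [conj_poly x e'] is fixed by Frobenius, so it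
    has coefficients in [F] and [P] divides it. Conversely [P] vanishes on the whole orbit, whose
    elements are distinct, so the two agree and [e = e']. *)
Lemma irrs_roots e P x : P \in irrs F e -> root P^i x ->
  [/\ P^i = conj_poly x e, uniq [seq x ^+ (p ^ i) | i <- iota 0 e],
      x ^+ (p ^ e) = x, (0 < e)%N & (e %| k)%N].
Proof.
move=> /mem_irrs[iP Pm sP] hx.
have ex : exists n, (0 < n)%N && (x ^+ (p ^ n) == x).
  by exists k; rewrite k_gt0 -cardK expf_card /=.
case: (ex_minnP ex) => e' /andP[e'0 /eqP xe'] hmin.
have ux : uniq [seq x ^+ (p ^ i) | i <- iota 0 e'].
  rewrite map_inj_in_uniq ?iota_uniq // => i j; rewrite !mem_iota /= !add0n.
  wlog ij : i j / (i <= j)%N.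
    by move=> h hi hj e1; case/orP: (leq_total i j) => ?; [|symmetry]; apply: h.
  move=> hi hj; rewrite -(subnK ij) expnD exprM => /(@expr_pchar_pow_inj i) e1.
  have [/hmin|] := boolP ((0 < j - i)%N && (x ^+ (p ^ (j - i)) == x)); first by lia.
  rewrite -e1 eqxx andbT -eqn0Ngt => /eqP; lia.
have E : P^i = conj_poly x e'.
  have [g0 Eg0] := frobenius_fixed_poly (conj_poly_frob e'0 xe').
  have cE : conj_poly x e' = \prod_(z <- [seq x ^+ (p ^ i) | i <- iota 0 e']) ('X - z%:P).
    by rewrite big_map -[e' in iota _ e']subn0 big_mkord.
  apply/eqP; rewrite -eqp_monic ?map_monic //; last first.
    by rewrite cE monic_prod_XsubC.
  rewrite /eqp; apply/andP; split.
    rewrite Eg0 dvdp_map; apply: (irreducible_dvd_root iP hx).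
    rewrite -Eg0 cE root_prod_XsubC; apply/mapP; exists 0%N; rewrite ?mem_iota //.
  rewrite cE uniq_roots_dvdp //; last by rewrite uniq_rootsE.
  by apply/allP => z /mapP[i _ ->]; apply: root_frobenius.
have ee' : e = e'.
  have := congr1 (fun q : {poly K} => size q) E; rewrite size_map_poly sP.
  by rewrite /conj_poly size_prod_XsubC /index_enum -enumT size_enum_ord => -[].
rewrite -ee' in xe' e'0 hmin ux E; split=> //.
(* The remainder of [k] modulo [e] is again a period, below the least positive one, hence zero. *)
rewrite /dvdn; have : x ^+ (p ^ (k %% e)) = x.
  have y n : x ^+ (p ^ (n * e)) = x.
    by elim: n => [|n IH]; rewrite ?mul0n ?expn0 ?expr1 // mulSn expnD exprM xe'.
  have : x ^+ (p ^ k) = x by rewrite -cardK expf_card.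
  by rewrite {1}(divn_eq k e) expnD exprM y.
move=> hk; rewrite -leqn0 leqNgt; apply/negP => h0.
have := hmin (k %% e)%N; rewrite h0 hk eqxx => /(_ isT).
by rewrite leqNgt ltn_mod e'0.
Qed.

Lemma irreducible_factor_root (g : {poly F}) x : g != 0 -> root g^i x ->
  exists2 P, [/\ irreducible_poly P, P \is monic & P %| g] & root P^i x.
Proof.
have [n] := ubnP (size g); elim: n g => // n IH g sgn g0 gx.
have sg : (1 < size g)%N.
  rewrite ltn_neqAle size_poly_gt0 g0 andbT eq_sym; apply/negP => /eqP/eqP s1.
  move: gx; case/size_poly1P: s1 => c c0 ->.
  by rewrite map_polyC rootC fmorph_eq0 (negbTE c0).
have [P [iP Pm Pg]] := irreducible_divisor sg.
have gE : g = (g %/ P) * P by rewrite divpK.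
move: (gx); rewrite {1}gE rmorphM rootM => /orP[h|h]; last by exists P.
have q0 : g %/ P != 0 by apply: contraNneq g0 => e0; rewrite gE e0 mul0r.
have [|Q [iQ Qm Qg] Qx] := IH (g %/ P) _ q0 h.
  rewrite (leq_trans _ (_ : size g <= n))%N //.
  rewrite size_divp ?monic_neq0 //; have := iP.1; move: sg; move: (size P) (size g) => a b; lia.
by exists Q => //; split=> //; rewrite gE dvdp_mulr.
Qed.

Lemma exists_irrs_root (x : K) :
  exists e P, [/\ P \in irrs F e, root P^i x & (e %| k)%N].
Proof.
have p1 := prime_gt1 p_prime.
have pk1 : (1 < p ^ k)%N by rewrite -(exp1n k) ltn_exp2r.
have sz : size ('X^(p ^ k) - 'X : {poly F}) = (p ^ k).+1.
  by rewrite size_polyDl ?size_polyN ?size_polyXn ?size_polyX.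
have [||P [iP Pm _] Px] := @irreducible_factor_root ('X^(p ^ k) - 'X) x.
- by rewrite -size_poly_eq0 sz.
- rewrite rmorphB rmorphXn /= map_polyX /root !hornerE subr_eq0.
  by rewrite -[X in _ == X]expf_card cardK.
have Pe : P \in irrs F (size P).-1.
  by apply/mem_irrs; split=> //; rewrite prednK // ltnW // iP.1.
by exists (size P).-1, P; case: (irrs_roots Pe Px).
Qed.

Lemma irrs_root_uniq e e' P P' x : P \in irrs F e -> P' \in irrs F e' ->
  root P^i x -> root P'^i x -> P = P'.
Proof.
move=> /mem_irrs[iP Pm _] /mem_irrs[iP' P'm _] hx hx'.
apply: contraNeq (not_coprime_root hx hx') => h.
exact: irreducible_monic_coprime.
Qed.

(** A root of [P] in an extension of degree [e] is fixed by the [p ^ k]-th power, so [P] divides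
    ['X^(p ^ k) - 'X], which over [K] is the product of all ['X - x]. *)
Lemma irrs_has_root e P : P \in irrs F e -> (e %| k)%N -> exists x, root P^i x.
Proof.
move=> /mem_irrs[iP Pm sP] ek.
have e0 : (0 < e)%N by have := iP.1; rewrite sP.
have dvd : P %| 'X^(p ^ k) - 'X.
  have [L dL [z Pz _]] := irredp_FAdjoin iP.
  pose fL := FinFieldExtType L.
  have cL : #|fL| = (p ^ e)%N.
    by rewrite -cardF -[e]/(e.+1.-1) -sP -dL -(@card_vspace _ fL) card_vspacef.
  have zp : z ^+ (p ^ k) = z.
    have z1 : z ^+ (p ^ e) = z by rewrite -cL; exact: (@expf_card fL z).
    rewrite -(divnK ek); elim: (k %/ e)%N => [|n IH]; first by rewrite mul0n expn0 expr1.
    by rewrite mulSn expnD exprM z1.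
  set Q := 'X^_ - _.
  have nc : ~~ coprimep P Q.
    apply/negP; rewrite -(coprimep_map (in_alg L)) => /coprimep_root /(_ Pz).
    by rewrite rmorphB rmorphXn /= map_polyX !hornerE zp subrr eqxx.
  have := iP.2 _ nc (dvdp_gcdl _ _); rewrite /eqp => /andP[_ h].
  exact: dvdp_trans h (dvdp_gcdr _ _).
apply: contrapT => nx.
have : P^i %| \prod_(x : K) ('X - x%:P).
  rewrite -finField_genPoly cardK -(map_polyX emb) -(rmorphXn (map_poly emb)) -rmorphB /=.
  by rewrite dvdp_map.
have : coprimep P^i (\prod_(x : K) ('X - x%:P)).
  apply: (big_ind (fun q => coprimep P^i q)); first exact: coprimep1.
    by move=> a b ha hb; rewrite coprimepMr ha hb.
  by move=> x _; rewrite coprimep_XsubC; apply/negP => h; apply: nx; exists x.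
move=> cp; rewrite -[X in _ %| X]mul1r Gauss_dvdpl // dvdp1 size_map_poly sP.
by case: e e0 {sP ek}.
Qed.

Lemma card_irrs_roots e P : P \in irrs F e -> (e %| k)%N ->
  #|[pred x | root P^i x]| = e.
Proof.
move=> Pe ek; have [x hx] := irrs_has_root Pe ek.
have [E ux _ _ _] := irrs_roots Pe hx.
rewrite -[RHS](size_iota 0) -(size_map (fun i => x ^+ (p ^ i))) -(card_uniqP ux).
apply: eq_card => y; rewrite inE E /conj_poly.
have -> : \prod_(i < e) ('X - (x ^+ (p ^ i))%:P) =
    \prod_(z <- [seq x ^+ (p ^ i) | i <- iota 0 e]) ('X - z%:P).
  by rewrite big_map -[in iota _ e](subn0 e) big_mkord.
by rewrite root_prod_XsubC.
Qed.

(** The elements of [K] are grouped by minimal polynomial: one of degree [e] dividing [k] has [e]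
    roots, which together give the term of [ssum] with exponent [j = k / e]. *)
Lemma sum_finite_field (C : comNzRingType) (Lam : {poly F} -> C) (phi : K -> C) :
  (forall e P x, P \in irrs F e -> root P^i x -> phi x = Lam P ^+ (k %/ e)) ->
  \sum_x phi x = ssum Lam k.
Proof.
move=> hphi.
transitivity (\sum_(1 <= e < k.+1) \sum_(P <- irrs F e) \sum_(x | root P^i x) phi x).
  transitivity (\sum_x phi x *+ (\sum_(1 <= e < k.+1) \sum_(P <- irrs F e) root P^i x)%N).
    apply: eq_bigr => x _; rewrite [X in _ *+ X](_ : _ = 1%N) ?mulr1n //.
    have [e0 [P0 [Pe0 Px0 e0k]]] := exists_irrs_root x.
    have [_ _ _ e00 _] := irrs_roots Pe0 Px0.
    transitivity (\sum_(1 <= e < k.+1 | e == e0) 1)%N; last first.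
      by rewrite big_nat1_eq e00 ltnS dvdn_leq.
    rewrite [RHS]big_mkcond /=; apply: eq_bigr => e _.
    transitivity (\sum_(P <- irrs F e) (P == P0 : nat))%N.
      rewrite big_seq [RHS]big_seq; apply: eq_bigr => P Pe.
      case: eqVneq => [->|ne]; first by rewrite Px0.
      by case: (boolP (root _ _)) => // h; rewrite (irrs_root_uniq Pe Pe0 h Px0) eqxx in ne.
    rewrite (eq_bigr (fun P => if P == P0 then 1%N else 0%N)); last by move=> P _; case: eqP.
    rewrite -big_mkcond sum1_count count_uniq_mem ?irrs_uniq //.
    have [-> //|ne] := eqVneq e e0; first by rewrite Pe0.
    case: (boolP (P0 \in _)) => // /mem_irrs[_ _ sP].
    by move: ne; case/mem_irrs: Pe0 => _ _; rewrite sP => -[->]; rewrite eqxx.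
  under eq_bigr do rewrite -sumrMnr.
  rewrite exchange_big /=; apply: eq_bigr => e _.
  under eq_bigr do rewrite -sumrMnr.
  rewrite exchange_big /=; apply: eq_bigr => P _.
  by rewrite [RHS]big_mkcond /=; apply: eq_bigr => x _; rewrite mulrb.
rewrite /ssum /ssum_bounded big_nat [RHS]big_nat; apply: eq_bigr => e /andP[e0 _].
rewrite big_seq [RHS]big_seq; apply: eq_bigr => P Pe.
have [ek|nek] := boolP (e %| k)%N.
  rewrite (eq_bigr (fun=> Lam P ^+ (k %/ e))) => [|x Px]; last exact: hphi Pe Px.
  rewrite sumr_const (card_irrs_roots Pe ek).
  rewrite (eq_bigl (fun j => j == (k %/ e)%N)) => [|j]; last first.
    by rewrite -{1}(divnK ek) eqn_pmul2r.
  by rewrite big_nat1_eq divn_gt0 // dvdn_leq //= ltnS leq_div.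
rewrite big1 => [|x Px]; last by case: (irrs_roots Pe Px) => _ _ _ _; rewrite (negbTE nek).
rewrite big1 // => j /eqP jk; by rewrite -jk dvdn_mull in nek.
Qed.

(** Transitivity of norms: [P.[a]] is the norm of [a - x] from the field generated by [x], its
    [k / e]-th power is the norm from [K], and that norm is the power with exponent
    [1 + p + ... + p^(k-1)]. *)
Lemma norm_conj_poly e P x a : P \in irrs F e -> root P^i x ->
  emb P.[a] ^+ (k %/ e) = (emb a - x) ^+ (\sum_(i < k) p ^ i).
Proof.
move=> Pe hx; have [E _ xe e0 ek] := irrs_roots Pe hx.
set y := emb a - x.
have ye : y ^+ (p ^ e) = y by rewrite exprB_pchar_pow xe emb_pow_card.
have -> : emb P.[a] = y ^+ (\sum_(i < e) p ^ i).
  rewrite -horner_map E /conj_poly horner_prod expr_sum; apply: eq_bigr => i _.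
  by rewrite hornerXsubC exprB_pchar_pow emb_pow_card.
rewrite -[in RHS](divnK ek); elim: (k %/ e)%N => [|n IH].
  by rewrite mul0n big_ord0 !expr0.
rewrite exprS IH mulSn big_split_ord /= exprD; congr (_ * _).
rewrite !expr_sum; apply: eq_bigr => i _.
by rewrite expnD exprM ye.
Qed.

End FrobeniusOrbits.

(** * Weil's bound *)

Lemma finField_fermat (F : finFieldType) (x : F) : x != 0 -> x ^+ #|F|.-1 = 1.
Proof.
move=> x0; apply: (mulfI x0); rewrite mulr1 -exprS prednK ?expf_card //.
by apply/card_gt0P; exists 0.
Qed.

Section Weil.
Variables (R : realType) (F : finFieldType) (p : nat) (chi : F -> R[i]).
Variable as_ : seq F.
Hypotheses (p_prime : prime p) (cardF : #|F| = p) (chi1 : chi 1 = 1) (chi0 : chi 0 = 0)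
  (chiM : forall x y, chi (x * y) = chi x * chi y)
  (chi_nontrivial : exists2 b, b != 0 & chi b != 1)
  (as0 : 0 \notin as_).

Lemma chiX x n : chi (x ^+ n) = chi x ^+ n.
Proof. by elim: n => [|n IH]; rewrite ?expr0 ?chi1 // !exprS chiM IH. Qed.

Lemma nm_chi x : x != 0 -> nm (chi x) = 1.
Proof.
move=> x0; apply/eqP; rewrite -(@pexpr_eq1 _ _ p.-1) ?nm_ge0 //; last by have := prime_gt1 p_prime; case: (p) => [|[]].
by rewrite -nmX -chiX -cardF finField_fermat ?chi1 ?nm1.
Qed.

Lemma nm_chi_le1 x : nm (chi x) <= 1.
Proof. by have [->|/nm_chi->//] := eqVneq x 0; rewrite chi0 nm0 ler01. Qed.

Lemma sum_chi : \sum_(x | x != 0) chi x = 0.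
Proof.
have [b b0 chib] := chi_nontrivial.
set S := \sum_(x | _) _.
have : chi b * S = S.
  rewrite big_distrr /= [RHS](reindex (fun x => b * x)) /=; last first.
    by apply/onW_bij; exists (fun x => b^-1 * x) => x; rewrite mulrA ?mulVf ?mulfV ?mul1r.
  by apply: eq_big => x; rewrite ?chiM // mulf_eq0 (negbTE b0).
move/eqP; rewrite -subr_eq0 -{2}[S]mul1r -mulrBl mulf_eq0 subr_eq0 (negbTE chib).
by move/eqP.
Qed.

Lemma p_gt2 : (2 < p)%N.
Proof.
have := prime_gt1 p_prime; rewrite leq_eqVlt => /orP[/eqP p2|//].
have [b b0 /eqP[]] := chi_nontrivial.
by have := finField_fermat b0; rewrite cardF -p2 expr1 => ->.
Qed.

(** Its sum over the monic ['X + x] is the sum to be bounded. The list may repeat points but avoids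
    [0], so the value at [0] enters exactly once; this drives the vanishing in high degree. *)
Definition char_Lam (g : {poly F}) := chi (g.[0] * \prod_(a <- as_) g.[a]).

Lemma char_Lam1 : char_Lam 1 = 1.
Proof. by rewrite /char_Lam hornerC mul1r big1 // => a _; rewrite hornerC. Qed.

Lemma char_LamM g h : char_Lam (g * h) = char_Lam g * char_Lam h.
Proof.
rewrite /char_Lam -chiM hornerM (eq_bigr (fun a => g.[a] * h.[a])); last first.
  by move=> a _; rewrite hornerM.
by rewrite big_split /=; congr chi; ring.
Qed.

(* Adding a multiple of a polynomial that vanishes at the points of [as_]
   multiplies [g.[0]] by a constant of nontrivial character. *)
Lemma csum_char_eq0 n : (size (undup as_) < n)%N -> csum char_Lam n = 0.
Proof.
move=> hn; have [b b0 chib] := chi_nontrivial.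
pose l0 := \prod_(a <- undup as_) ('X - a%:P).
have l00 : l0.[0] != 0.
  rewrite horner_prod prodf_seq_neq0; apply/allP => a; rewrite mem_undup => aas.
  by rewrite hornerXsubC sub0r oppr_eq0 /=; apply: contraNneq as0 => <-.
pose l := l0.[0]^-1 *: l0.
have l1 : l.[0] = 1 by rewrite hornerZ mulVf.
have la a : a \in as_ -> l.[a] = 0.
  move=> aas; suff l0a : l0.[a] = 0 by rewrite hornerZ l0a mulr0.
  rewrite horner_prod (big_rem a) ?mem_undup //=.
  by rewrite hornerXsubC subrr mul0r.
have sl : (size l <= n)%N by rewrite size_scale ?invr_eq0 // size_prod_XsubC.
(* Changes the value at [0] by the factor [c] and no value on [as_]. As [l] has degree below [n],
   monic polynomials of degree [n] are preserved. *)
pose T c (g : {poly F}) := g + ((c - 1) * g.[0]) *: l.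
have T0 c g : (T c g).[0] = c * g.[0] by rewrite /T hornerD hornerZ l1; ring.
have Ta c g a : a \in as_ -> (T c g).[a] = g.[a].
  by move=> aas; rewrite /T hornerD hornerZ la // mulr0 addr0.
have TK : cancel (T b) (T b^-1).
  move=> g; rewrite {1}/T T0 /T -addrA -scalerDl [X in X *: _](_ : _ = 0) ?scale0r ?addr0 //.
  by field.
have Tm g : g \in monics _ n -> T b g \in monics _ n.
  rewrite !mem_monics => /andP[gm /eqP sg].
  have s1 : (size (((b - 1) * g.[0]) *: l) < size g)%N.
    by rewrite sg ltnS; apply: leq_trans (size_scale_leq _ _) sl.
  by rewrite monicE lead_coefDl // -monicE gm size_polyDl // sg eqxx.
have um : uniq (map (T b) (monics F n)).
  by rewrite map_inj_uniq ?monics_uniq //; apply: can_inj TK.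
have pm : perm_eq (map (T b) (monics _ n)) (monics F n).
  apply: uniq_perm => //; first exact: monics_uniq.
  have [] := uniq_min_size um (_ : {subset map (T b) (monics _ n) <= monics _ n}) _ => //.
    by move=> g /mapP[h hm ->]; apply: Tm.
  by rewrite (size_map (T b)).
have : csum char_Lam n = chi b * csum char_Lam n.
  rewrite {1}/csum -(perm_big _ pm) big_map /= big_distrr /=; apply: eq_bigr => g _.
  rewrite /char_Lam T0 -mulrA chiM; congr (_ * chi (_ * _)).
  by rewrite big_seq [RHS]big_seq; apply: eq_bigr => a aas; rewrite Ta.
move/eqP; rewrite -subr_eq0 -{1}[csum _ _]mul1r -mulrBl mulf_eq0 subr_eq0 eq_sym (negbTE chib).
by move/eqP.
Qed.

(** The factor [4 * m + 12] of [stepanov_bound] at [m = (size as_).+1]. *)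
Let cc := (4 * (size as_).+1 + 12)%N.

(** The number [N a] of points with norm [a] is at most [A]. As the values of [chi] sum to zero,
    [N a] may be replaced by the deficit [A - N a], which is nonnegative. The deficits add up to
    [O(M)], since [(p - 1) * u * M] is at most [M ^ 2] and nearly all of the [M ^ 2] points are
    counted. *)
Lemma ssum_char_bound (K : finFieldType) (emb : {rmorphism F -> K}) mu :
  p \in [pchar K] -> (0 < mu)%N -> #|K| = (p ^ (2 * mu))%N ->
  nm (ssum char_Lam (2 * mu)) <= (p.-1 * cc + (size as_).+1)%:R * p%:R ^+ mu.
Proof.
move=> pK mu0 cK.
have p2 := p_gt2.
pose M := (p ^ mu)%N; pose u := (\sum_(i < mu) p ^ i)%N; pose d := p.-1.
have Mdu : M = (d * u).+1.
  by rewrite /d /u -predn_exp prednK // expn_gt0 prime_gt0.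
have M2 : (2 < M)%N by rewrite (leq_trans p2) // -{1}(expn1 p) leq_exp2l // prime_gt1.
have u0 : (0 < u)%N by rewrite lt0n; apply/eqP => e0; rewrite e0 muln0 in Mdu; rewrite Mdu in M2.
have d0 : (0 < d)%N by rewrite /d; case: (p) p2 => [|[]].
have cKM : #|K| = (M ^ 2)%N by rewrite cK /M -expnM mulnC.
pose G := (\sum_(i < 2 * mu) p ^ i)%N.
(* The norm exponent [(M ^ 2 - 1) / (p - 1)] in the form required by [stepanov_bound]. *)
have GE : G = (u * M.+1)%N.
  rewrite /G mul2n -addnn big_split_ord /= mulnS; congr addn.
  by rewrite big_distrl /=; apply: eq_bigr => i _; rewrite expnD mulnC.
(* The sign makes ['X * f1] the product of [0 - x] and the [a - x], the elements whose norms
   [norm_conj_poly] computes. *)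
pose f1 : {poly K} := - \prod_(a <- as_) ((emb a)%:P - 'X).
have fE x : ('X * f1).[x] = (emb 0 - x) * \prod_(a <- as_) (emb a - x).
  rewrite hornerM hornerX hornerN horner_prod rmorph0 sub0r mulrN mulNr; congr (- (_ * _)).
  by apply: eq_bigr => a _; rewrite !hornerE.
have f10 : f1.[0] != 0.
  rewrite hornerN oppr_eq0 horner_prod prodf_seq_neq0; apply/allP => a aas /=.
  by rewrite hornerD hornerN hornerX hornerC subr0 fmorph_eq0; apply: contraNneq as0 => <-.
have sf1 : (size f1 <= (size as_).+1)%N.
  rewrite size_polyN.
  elim: (as_) => [|a s IH]; first by rewrite big_nil size_poly1.
  rewrite big_cons; apply: leq_trans (size_polyMleq _ _) _.
  have : (size ((emb a)%:P - 'X)%R <= 2)%N.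
    by rewrite -opprB size_polyN size_XsubC.
  by move=> h; rewrite -subn1 leq_subLR (leq_trans (leq_add h IH)).
(* A left inverse of [emb]; the default [0] is harmless because only norms, which lie in the image,
   are fed to it. *)
pose inv (y : K) : F := odflt 0 [pick a | emb a == y].
have invK a : inv (emb a) = a.
  rewrite /inv; case: pickP => [b /eqP /fmorph_inj //|/(_ a)]; by rewrite eqxx.
pose phi x := chi (inv (('X * f1).[x] ^+ G)).
have S_E : \sum_x phi x = ssum char_Lam (2 * mu).
  apply: (sum_finite_field pK cardF cK _ (emb := emb)) => [|e P x Pe Px]; first by rewrite muln_gt0.
  rewrite /phi /char_Lam -chiX; congr chi.
  rewrite -[RHS]invK; congr inv.
  rewrite rmorphXn rmorphM /= rmorph_prod /= exprMn -prodrXl fE exprMn -prodrXl.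
  rewrite (norm_conj_poly pK cardF cK _ 0 Pe Px) ?muln_gt0 //; congr (_ * _).
  by apply: eq_bigr => a _; rewrite (norm_conj_poly pK cardF cK _ a Pe Px) ?muln_gt0.
pose N a := #|[pred x | ('X * f1).[x] ^+ G == emb a]|.
pose A := (M * u + M * cc)%N.
have NA a : a != 0 -> (N a <= A)%N.
  move=> a0; rewrite /N GE; apply: stepanov_bound pK (erefl _) cKM Mdu d0 u0 M2 f10 sf1 _.
  by rewrite fmorph_eq0.
have fn0 x : ('X * f1).[x] != 0 -> exists2 a, a != 0 & ('X * f1).[x] ^+ G = emb a.
  move=> h; have [|a Ha] := @frobenius_fixed _ _ emb p pK cardF (('X * f1).[x] ^+ G).
    rewrite -[p in X in X = _]prednK ?prime_gt0 // exprS -exprM.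
    have -> : (G * p.-1 = (p ^ (2 * mu)).-1)%N by rewrite predn_exp mulnC.
    by rewrite -cK finField_fermat // mulr1.
  exists a => //; rewrite -(fmorph_eq0 emb) -Ha expf_neq0 //.
have S_N : \sum_x phi x = \sum_(a | a != 0) chi a * (N a)%:R.
  rewrite (bigID (fun x => ('X * f1).[x] == 0)) /= big1 ?add0r; last first.
    move=> x /eqP h; rewrite /phi h expr0n.
    have -> : (G == 0%N) = false by rewrite GE muln_eq0 (gtn_eqF u0).
    by rewrite mulr0n -(rmorph0 emb) invK chi0.
  transitivity (\sum_(x | ('X * f1).[x] != 0) \sum_(a | (a != 0) && (('X * f1).[x] ^+ G == emb a)) chi a).
    apply: eq_bigr => x /fn0[a a0 Ha]; rewrite /phi Ha invK (big_pred1 a) // => b /=.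
    rewrite (inj_eq (fmorph_inj emb)) (eq_sym a b); have [->|_] := eqVneq b a; by rewrite ?a0 ?andbF.
  rewrite (exchange_big_dep (fun a => a != 0)) /=; last by move=> x a _ /andP[].
  apply: eq_bigr => a a0; rewrite sumr_const mulr_natr; congr (_ *+ _).
  apply: eq_card => x; rewrite -!topredE /= a0 /=.
  apply/andP/idP => [[_ ->] //|h]; split=> //.
  apply/eqP => h0; move: h; rewrite h0 expr0n.
  have -> : (G == 0%N) = false by rewrite GE muln_eq0 (gtn_eqF u0).
  by rewrite mulr0n eq_sym fmorph_eq0 (negbTE a0).
pose nz (x : K) := ('X * f1).[x] != 0.
pose tgt a (x : K) := ('X * f1).[x] ^+ G == emb a.
have cN : (M ^ 2 <= \sum_(a : F | a != 0%R) N a + (size as_).+1)%N.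
  rewrite -cKM -(cardC [pred x | ('X * f1).[x] == 0]) addnC leq_add //.
    have -> : (\sum_(a : F | a != 0%R) N a = \sum_(x : K | nz x) 1)%N.
      transitivity (\sum_(a : F | a != 0%R) \sum_(x : K | tgt a x) 1)%N.
        by apply: eq_bigr => a _; rewrite sum1_card.
      rewrite (exchange_big_dep nz) /=; last first.
        move=> a x a0 /eqP h; apply/eqP => h0; move: h; rewrite h0 expr0n.
        have -> : (G == 0%N) = false by rewrite GE muln_eq0 (gtn_eqF u0).
        by rewrite mulr0n => /esym/eqP; rewrite fmorph_eq0 (negbTE a0).
      apply: eq_bigr => x /fn0[a a0 Ha]; rewrite (big_pred1 a) // => b /=.
      rewrite /tgt Ha (inj_eq (fmorph_inj emb)) (eq_sym a b); have [->|_] := eqVneq b a; by rewrite ?a0 ?andbF.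
    by rewrite sum1_card; apply: eq_leq; apply: eq_card => x; rewrite !inE.
  have f0 : 'X * f1 != 0.
    by rewrite mulf_neq0 ?polyX_eq0 //; apply: contraNneq f10 => ->; rewrite horner0.
  rewrite cardE -ltnS; apply: leq_trans (max_poly_roots f0 _ (enum_uniq _)) _.
    by apply/allP => x; rewrite mem_enum inE.
  by apply: leq_trans (size_polyMleq _ _) _; rewrite size_polyX.
rewrite -S_E S_N.
have -> : \sum_(a | a != 0) chi a * (N a)%:R =
          - \sum_(a | a != 0) chi a * (A - N a)%:R.
  apply/eqP; rewrite -addr_eq0 -big_split /= (eq_bigr (fun a => chi a * A%:R)).
    by rewrite -big_distrl /= sum_chi mul0r.
  by move=> a a0; rewrite -mulrDr -natrD subnKC ?NA.
rewrite nmN; apply: le_trans (nm_sum _ _ _) _.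
apply: (@le_trans _ _ (\sum_(a : F | a != 0) (A - N a)%:R)).
  by apply: ler_sum => a a0; rewrite nmM nm_nat ler_piMl // nm_chi_le1.
rewrite -natr_sum -natrX -natrM ler_nat.
have -> : (\sum_(a : F | a != 0%R) (A - N a) = p.-1 * A - \sum_(a : F | a != 0%R) N a)%N.
  have cF : (\sum_(a : F | a != 0%R) A = p.-1 * A)%N.
    by rewrite sum_nat_const -[in RHS]cardF -(cardC1 (0 : F)); congr (_ * _)%N.
  by rewrite -cF -sumnB // => a a0; apply: NA.
rewrite -/M /A -/d.
move: cN; move: (\sum_(_ | _) _)%N => Z; rewrite leq_subLR.
move: cc => c; move: (size as_).+1 => s hZ.
have e1 : (d * (M * u + M * c) = (d * u) * M + d * c * M)%N by ring.
have e2 : ((d * u) * M <= M ^ 2)%N by rewrite expnS expn1 leq_mul2r; lia.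
have e3 : ((d * c + s) * M = d * c * M + s * M)%N by ring.
have e4 : (s <= s * M)%N by rewrite leq_pmulr //; lia.
lia.
Qed.

Lemma csum_char1 :
  csum char_Lam 1 = \sum_x chi (x * \prod_(a <- as_) (a + x)).
Proof.
have pm : perm_eq (monics F 1) [seq 'X + c%:P | c <- enum F].
  apply: uniq_perm; first exact: monics_uniq.
    by rewrite map_inj_uniq ?enum_uniq // => a b /addrI /polyC_inj.
  move=> g; rewrite mem_monics; apply/andP/mapP => [[gm /eqP sg]|[c _ ->]].
    exists g`_0; first by rewrite mem_enum.
    apply/polyP => i; rewrite coefD coefX coefC.
    case: i => [|[|i]] /=; rewrite ?add0r ?addr0 //; last by rewrite nth_default // sg.
    by move: gm; rewrite monicE lead_coefE sg => /eqP.
  by rewrite -['X + _]/(_) -(opprK c) polyCN monicXsubC size_XsubC.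
rewrite /csum (perm_big _ pm) big_map big_enum /=; apply: eq_bigr => x _.
rewrite /char_Lam !hornerE; congr (chi (_ * _)).
by apply: eq_bigr => a _; rewrite !hornerE.
Qed.

Hypothesis extension : forall k, (0 < k)%N ->
  exists (K : finFieldType) (emb : {rmorphism F -> K}),
    p \in [pchar K] /\ #|K| = (p ^ k)%N.

(** The L-function is a polynomial with at most [size (undup as_)] reciprocal roots, and
    [csum char_Lam 1] is minus their sum. The constant in [ssum_char_bound] does not depend on [mu],
    so [power_sums_bounded] removes it. *)
Lemma weil_bound :
  nm (\sum_x chi (x * \prod_(a <- as_) (a + x))) <=
  (size (undup as_))%:R * Num.sqrt p%:R.
Proof.
have p0 := prime_gt0 p_prime.
have [s ss sE] := @log_derivative_power_sums R[i] (csum char_Lam)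
  (fun k => ssum char_Lam k.+1) _ (csum0 char_Lam1)
  (csum_recurrence char_Lam1 char_LamM) csum_char_eq0.
have c1 : csum char_Lam 1 = - \sum_(a <- s) a.
  have := csum_recurrence char_Lam1 char_LamM 0.
  rewrite mulr1n big_ord1 /= subn0 csum0 ?char_Lam1 // mulr1 sE => ->.
  by congr (- _); apply: eq_bigr => a _; rewrite expr1.
have sb a : a \in s -> nm a <= Num.sqrt p%:R.
  move=> as1; rewrite -(ler_pXn2r (_ : 0 < 2)%N) ?nnegrE ?nm_ge0 ?sqrtr_ge0 //.
  rewrite sqr_sqrtr ?ler0n // -nmX.
  (* Extensions of degree [2 * n.+1] give the power sums of the squares, hence [nm a ^+ 2 <= p]. *)
  apply: (@power_sums_bounded R [seq x ^+ 2 | x <- s] p%:R (p.-1 * cc + (size as_).+1)%:R); last exact: map_f.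
    by rewrite ltr0n.
  move=> n; rewrite big_map.
  have [|K [emb [pK cK]]] := extension (k := 2 * n.+1); first by [].
  have := @ssum_char_bound K emb n.+1 pK isT cK.
  rewrite mulnS addSn sE nmN; congr (nm _ <= _).
  by apply: eq_bigr => x _; rewrite -exprM mulnS addSn.
rewrite -csum_char1 c1 nmN; apply: le_trans (nm_sum _ _ _) _.
apply: (@le_trans _ _ ((size s)%:R * Num.sqrt p%:R)); last first.
  by rewrite ler_wpM2r ?sqrtr_ge0 // ler_nat.
rewrite big_seq; apply: le_trans (ler_sum _ _) _; first by move=> a as1; exact: sb as1.
by rewrite -big_seq big_const_seq count_predT iter_addr_0 mulr_natl.
Qed.

End Weil.

Lemma Fp_extension p k : prime p -> (0 < k)%N ->
  exists (K : finFieldType) (emb : {rmorphism 'F_p -> K}),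
    p \in [pchar K] /\ #|K| = (p ^ k)%N.
Proof.
move=> pp k0; have [K pK cK] := pPrimePowerField pp k0.
by exists (pPrimeCharType pK), (GRing.in_alg (pPrimeCharType pK)).
Qed.

(** * Divisors and the quadratic Vinogradov system *)

Section DivisorBound.
Variable R : realType.

Definition tau n := size (divisors n).

Lemma tau_pfactor n p : (0 < n)%N -> prime p ->
  (tau n <= (logn p n).+1 * tau n`_p^')%N.
Proof.
move=> n0 pp; rewrite /tau -(size_iota 0 (logn p n).+1) -(size_allpairs (fun i d => p ^ i * d)%N).
apply: uniq_leq_size; first exact: divisors_uniq.
move=> d; rewrite -dvdn_divisors // => dn.
have d0 : (0 < d)%N by apply: dvdn_gt0 dn.
apply/allpairsP; exists (logn p d, d`_p^')%N => /=; split.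
- by rewrite -[_ :: _]/(iota 0 (logn p n).+1) mem_iota ltnS dvdn_leq_log.
- by rewrite -dvdn_divisors ?part_gt0 // partn_dvd.
- by rewrite -p_part partnC.
Qed.

Lemma powR_le2l (x y a : R) : 0 <= a -> 0 <= x -> x <= y -> x `^ a <= y `^ a.
Proof.
by move=> a0 x0 xy; apply: ge0_ler_powR; rewrite ?nnegrE // (le_trans x0).
Qed.

(* Prime powers [p ^ e] with [p ^ eps >= 2] satisfy [e + 1 <= p ^ (eps e)];
   each of the finitely many other primes costs a constant factor. *)
Lemma divisor_bound (eps : R) : 0 < eps ->
  exists2 C : R, 1 <= C & forall n, (0 < n)%N -> (tau n)%:R <= C * n%:R `^ eps.
Proof.
move=> e0.
have c1 : 1 < (2 : R) `^ eps.
  by rewrite /powR ifF ?gt_eqF ?ltr0n // expR_gt1 mulr_gt0 // ln_gt0 // ltr1n.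
set c := 2 `^ eps in c1.
(* With this [K], Bernoulli's inequality gives [e + 1 <= K * (1 + e * (c - 1)) <= K * c ^+ e]. *)
pose K := 1 + (c - 1)^-1.
have iv0 : 0 < (c - 1)^-1 by rewrite invr_gt0 subr_gt0.
have K1 : 1 <= K by rewrite /K lerDl ltW.
pose L := (Num.bound (2 `^ eps^-1)).+1.
have hL p : (L <= p)%N -> 2 <= (p%:R : R) `^ eps.
  move=> Lp.
  have h : 2 `^ eps^-1 <= (p%:R : R).
    apply: (@le_trans _ _ L%:R); last by rewrite ler_nat.
    by apply: ltW; apply: lt_trans (archi_boundP (powR_ge0 _ _)) _; rewrite ltr_nat.
  by have := powR_le2l (ltW e0) (powR_ge0 _ _) h; rewrite -powRrM mulVf ?gt_eqF // powRr1.
have hK e p : (1 < p)%N -> (e.+1)%:R <= K * (p%:R `^ eps) ^+ e.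
  move=> p1.
  have cp : c <= (p%:R : R) `^ eps.
    by apply: powR_le2l; rewrite ?ler_nat // ltW.
  apply: (@le_trans _ _ (K * c ^+ e)); last first.
    apply: ler_wpM2l; first exact: le_trans ler01 K1.
    by apply: lerXn2r; rewrite ?nnegrE ?powR_ge0.
  apply: (@le_trans _ _ (K * (1 + e%:R * (c - 1)))).
    rewrite /K mulrDl mul1r [X in _ <= _ + X]mulrDr mulrCA mulVf ?gt_eqF ?subr_gt0 // !mulr1 -natr1.
    have : 0 <= e%:R * (c - 1) by rewrite mulr_ge0 // subr_ge0 ltW.
    lra.
  by rewrite ler_wpM2l ?bernoulli ?ltW // (lt_le_trans ltr01).
have hS e p : (L <= p)%N -> (e.+1)%:R <= ((p%:R : R) `^ eps) ^+ e.
  move=> Lp; apply: (@le_trans _ _ (2 ^+ e)).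
    by rewrite -natrX ler_nat; elim: (e) => // i IH; rewrite expnS; lia.
  by apply: lerXn2r; rewrite ?nnegrE ?powR_ge0 ?hL.
(* The number of prime divisors of [n] below [L], each of which costs a factor [K]; it never exceeds
   [L]. *)
pose w n := (\sum_(i < L) (nat_of_ord i \in primes n))%N.
have claim n : (0 < n)%N -> (tau n)%:R <= K ^+ w n * n%:R `^ eps.
  elim/ltn_ind: n => n IH n0.
  have [n1|n1] := leqP n 1.
    have -> : n = 1%N by lia.
    by rewrite powR1 mulr1; apply: exprn_ege1.
  pose p := pdiv n; have pp : prime p by rewrite pdiv_prime.
  have pn : (p %| n)%N by rewrite pdiv_dvd.
  set n' := (n`_p^')%N; set e := logn p n.
  have n'0 : (0 < n')%N by rewrite part_gt0.
  have nE : n = (p ^ e * n')%N by rewrite -p_part partnC.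
  have e1 : (0 < e)%N by rewrite logn_gt0 mem_primes pp n0.
  have pe1 : (1 < p ^ e)%N by rewrite -(exp1n e) ltn_exp2r // prime_gt1.
  have n'n : (n' < n)%N by rewrite nE ltn_Pmull.
  have wn : (w n' + (p < L) <= w n)%N.
    have -> : (p < L : nat) = (\sum_(i < L) (nat_of_ord i == p))%N.
      case: ltnP => pL.
        rewrite (bigD1 (Ordinal pL)) //= eqxx big1 // => i ip.
        by apply/eqP; rewrite eqb0; apply: contraNneq ip => h; apply/eqP/val_inj.
      by rewrite big1 // => i _; rewrite ltn_eqF // (leq_trans _ pL).
    rewrite -big_split /=; apply: leq_sum => i _.
    have [ip|ip] := eqVneq (nat_of_ord i) p.
      have -> : (nat_of_ord i \in primes n') = false.
        rewrite ip mem_primes; apply/negP => /and3P[_ _ h].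
        have := part_pnat p^' n => /pnatP; rewrite -/n' => /(_ n'0 p pp h).
        by rewrite inE /= inE eqxx.
      by rewrite ip mem_primes pp n0 pn.
    rewrite addn0; case: (boolP (_ \in primes n')) => //.
    rewrite !mem_primes => /and3P[-> _ h]; rewrite n0 /= (dvdn_trans h) //.
    by rewrite nE dvdn_mull.
  have K0 : 0 <= K by apply: le_trans K1.
  apply: (@le_trans _ _ (e.+1%:R * (tau n')%:R)); first by rewrite -natrM ler_nat tau_pfactor.
  have h1 := IH n' n'n n'0.
  have nEp : (n%:R : R) `^ eps = (p%:R `^ eps) ^+ e * n'%:R `^ eps.
    rewrite {1}nE natrM powRM ?ler0n // natrX -powR_mulrn ?ler0n // -!powRrM.
    by rewrite -(powR_mulrn e (powR_ge0 _ _)) -powRrM (mulrC eps).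
  rewrite nEp.
  apply: (@le_trans _ _ (e.+1%:R * (K ^+ w n' * n'%:R `^ eps))); first by rewrite ler_wpM2l.
  have h2 : e.+1%:R <= K ^+ (p < L) * (p%:R `^ eps) ^+ e.
    case: ltnP => pL; first by rewrite expr1 hK // prime_gt1.
    by rewrite expr0 mul1r hS.
  apply: (@le_trans _ _ (K ^+ (p < L) * (p%:R `^ eps) ^+ e * (K ^+ w n' * n'%:R `^ eps))).
    by rewrite ler_wpM2r // mulr_ge0 ?exprn_ge0 ?powR_ge0.
  rewrite mulrACA -exprD mulrA addnC -mulrA.
  rewrite ler_wpM2r ?mulr_ge0 ?exprn_ge0 ?powR_ge0 //.
  exact: ler_weXn2l.
exists (K ^+ L); first exact: exprn_ege1.
move=> n n0; apply: le_trans (claim n n0) _.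
rewrite ler_wpM2r ?powR_ge0 //; apply: ler_weXn2l => //.
rewrite /w; apply: leq_trans (_ : \sum_(i < L) 1 <= _)%N; last by rewrite sum1_card card_ord.
by apply: leq_sum => i _; case: (_ \in _).
Qed.

End DivisorBound.

Section CountPairs.

Lemma card_pair_fibers (T1 T2 : finType) (S : {set T1 * T2}) :
  #|S| = (\sum_(x : T1) #|[set y | (x, y) \in S]|)%N.
Proof.
rewrite -sum1_card.
rewrite [RHS](eq_bigr (fun x => \sum_(y | (x, y) \in S) 1)%N); last first.
  by move=> x _; rewrite -sum1_card; apply: eq_bigl => y; rewrite inE.
by rewrite pair_big_dep /=; apply: eq_bigl => -[x y].
Qed.

Lemma card_pairs_key (T1 T2 : finType) (V : eqType) (f : T1 -> V) (g : T2 -> V)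
    (ks : seq V) : uniq ks -> (forall x, f x \in ks) ->
  #|[set xy : T1 * T2 | f xy.1 == g xy.2]| =
  (\sum_(v <- ks) #|[set x | f x == v]| * #|[set y | g y == v]|)%N.
Proof.
move=> uk fk.
transitivity (\sum_(x : T1) \sum_(y : T2) (f x == g y))%N.
  rewrite -sum1_card pair_bigA /= big_mkcond; apply: eq_bigr => xy _.
  by rewrite inE; case: (_ == _).
transitivity (\sum_(x : T1) \sum_(y : T2) \sum_(v <- ks) (f x == v) * (g y == v))%N.
  apply: eq_bigr => x _; apply: eq_bigr => y _.
  rewrite (bigD1_seq (f x)) //= eqxx mul1n big1 ?addn0; first by rewrite eq_sym.
  by move=> v vx; rewrite eq_sym (negbTE vx).
transitivity (\sum_(v <- ks) \sum_(x : T1) \sum_(y : T2) (f x == v) * (g y == v))%N.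
  under eq_bigr do rewrite exchange_big.
  by rewrite exchange_big.
apply: eq_bigr => v _.
rewrite -!sum1_card big_distrl /= [RHS]big_mkcond /=; apply: eq_bigr => x _.
rewrite inE; case: (f x == v); last by rewrite big1 // => y _; rewrite mul0n.
rewrite mul1n [RHS]big_mkcond; apply: eq_bigr => y _.
by rewrite inE mul1n; case: (_ == _).
Qed.

(** With [m v] the size of the fiber over [v], the left side is the sum of [m v * m (v - c)]. Now
    [2 a b <= a^2 + b^2], and translation by [c] does not change the sum of squares. *)
Lemma card_pairs_shift (T : finType) (V : zmodType) (f : T -> V) (c : V) :
  (#|[set xy : T * T | f xy.1 == (f xy.2 + c)%R]| <=
   #|[set xy : T * T | f xy.1 == f xy.2]|)%N.
Proof.
pose g y := f y + c.
pose ks := undup (codom f ++ codom g).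
have uk : uniq ks by rewrite undup_uniq.
have fk x : f x \in ks by rewrite mem_undup mem_cat codom_f.
have gk x : g x \in ks by rewrite mem_undup mem_cat codom_f orbT.
have E1 := card_pairs_key g uk fk.
have E2 := card_pairs_key f uk fk.
have E3 := card_pairs_key g uk gk.
have E4 : #|[set xy : T * T | g xy.1 == g xy.2]| = #|[set xy : T * T | f xy.1 == f xy.2]|.
  by apply: eq_card => xy; rewrite !inE (inj_eq (addIr c)).
rewrite -(leq_pmul2l (_ : 0 < 2)%N) // E1 mul2n -addnn [X in (_ <= X)%N]mul2n -addnn.
rewrite -[X in (_ <= _ + X)%N]E4 E2 E3 -!big_split /=; apply: leq_sum => v _.
rewrite addnn -mul2n; exact: (nat_Cauchy _ _).1.
Qed.

End CountPairs.

Section Vinogradov.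
Variable B : nat.

Definition key n (phi : {ffun 'I_n -> 'I_B}) : int * int :=
  (\sum_i (phi i)%:Z, \sum_i (phi i)%:Z ^+ 2).

Definition key3 (X : 'I_B * 'I_B * 'I_B) : int * int :=
  let: (x, y, z) := X in
  (x%:Z + y%:Z - z%:Z, x%:Z ^+ 2 + y%:Z ^+ 2 - z%:Z ^+ 2).

Let deg (X : 'I_B * 'I_B * 'I_B) := (X.1.2 == X.2) || (X.1.1 == X.2).

(** With [(s, t)] the key, [2 (z - y) (z - x) = s^2 - t]. *)
Lemma key3_prod x y z x' y' z' : key3 (x, y, z) = key3 (x', y', z') ->
  (z%:Z - y%:Z) * (z%:Z - x%:Z) = (z'%:Z - y'%:Z) * (z'%:Z - x'%:Z).
Proof. by move=> [e1 e2]; nia. Qed.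

(* [(z - y) (z - x)] is a function of the key, so off the degenerate triples
   a triple with given key is determined by the divisor [z - y]. *)
Lemma card_key3_fiber D X : ~~ deg X ->
  (forall m, (0 < m)%N -> (m <= B ^ 2)%N -> (tau m <= D)%N) ->
  (#|[set X' | key3 X == key3 X']| <= 2 * D)%N.
Proof.
case: X => [[x y] z] nd hD.
pose P := (z%:Z - y%:Z) * (z%:Z - x%:Z).
have P0 : P != 0.
  move: nd; rewrite /deg /= negb_or => /andP[h1 h2].
  rewrite mulf_neq0 // subr_eq0 eqz_nat; by rewrite eq_sym.
have mB : (0 < absz P <= B ^ 2)%N.
  rewrite absz_gt0 P0 /= abszM -mulnn.
  have hx := ltn_ord x; have hy := ltn_ord y; have hz := ltn_ord z.
  by apply: leq_mul; lia.
case/andP: mB => m0 mB.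
pose f (X : 'I_B * 'I_B * 'I_B) : int := X.2%:Z - X.1.2%:Z.
pose ws := [seq d%:Z | d <- divisors (absz P)] ++ [seq - d%:Z | d <- divisors (absz P)].
set A := [set _ | _].
apply: (@leq_trans (size ws)); last first.
  by rewrite size_cat !size_map addnn -mul2n leq_mul2l hD.
rewrite cardE -(size_map f); apply: uniq_leq_size.
  rewrite map_inj_in_uniq ?enum_uniq // => -[[x1 y1] z1] [[x2 y2] z2].
  rewrite !mem_enum !inE => /eqP k1 /eqP k2; rewrite /f /= => e1.
  have h1 := key3_prod k1; have h2 := key3_prod k2; rewrite -/P in h1 h2.
  have w0 : z1%:Z - y1%:Z != 0 by apply: contraNneq P0 => h; rewrite h1 h mul0r.
  have e2 : z1%:Z - x1%:Z = z2%:Z - x2%:Z.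
    by apply: (mulfI w0); rewrite -h1 h2 e1.
  have := k2; rewrite k1 => -[e3 _].
  have [a b c] : [/\ x1 = x2 :> nat, y1 = y2 :> nat & z1 = z2 :> nat].
    by split; lia.
  by rewrite (val_inj a) (val_inj b) (val_inj c).
move=> v /mapP[[[x1 y1] z1]]; rewrite mem_enum inE => /eqP k1 ->.
have h1 := key3_prod k1; rewrite -/P in h1; rewrite /f /=.
have dv : (absz (z1%:Z - y1%:Z) \in divisors (absz P)).
  by rewrite -dvdn_divisors // h1 abszM dvdn_mulr.
rewrite mem_cat; apply/orP.
have [h|h] := leP 0 (z1%:Z - y1%:Z); [left|right]; apply/mapP; exists (absz (z1%:Z - y1%:Z)) => //; lia.
Qed.

(** Each nondegenerate triple has at most [2 * D] partners. A degenerate one is [(s, v, v)] or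
    [(v, s, v)], with key [(s, s ^ 2)]; its partner is then degenerate with the same [s], leaving
    three free values and four patterns. *)
Lemma card_key3_pairs D :
  (forall m, (0 < m)%N -> (m <= B ^ 2)%N -> (tau m <= D)%N) ->
  (#|[set XX : ('I_B * 'I_B * 'I_B) * ('I_B * 'I_B * 'I_B) |
       key3 XX.1 == key3 XX.2]| <= (2 * D + 4) * B ^ 3)%N.
Proof.
move=> hD; set S := [set _ | _].
rewrite -(cardsID [set XX | deg XX.1] S) mulnDl addnC; apply: leq_add.
  apply: (@leq_trans (\sum_(X : 'I_B * 'I_B * 'I_B) 2 * D)); last first.
    by rewrite sum_nat_const !card_prod !card_ord; apply: eq_leq; ring.
  rewrite card_pair_fibers; apply: leq_sum => X _.
  have [dX|nX] := boolP (deg X).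
    by rewrite eq_card0 // => Y; rewrite !inE dX.
  apply: leq_trans (card_key3_fiber nX hD); apply: subset_leq_card.
  by apply/fintype.subsetP => Y; rewrite !inE => /andP[].
pose W := (bool * bool * ('I_B * 'I_B * 'I_B))%type.
pose mk (b : bool) (s v : 'I_B) := if b then (s, v, v) else (v, s, v).
pose g (w : W) := (mk w.1.1 w.2.1.1 w.2.1.2, mk w.1.2 w.2.1.1 w.2.2).
have -> : (4 * B ^ 3 = #|{: W}|)%N by rewrite !card_prod card_bool !card_ord; ring.
apply: leq_trans (leq_imset_card g (mem predT)).
apply: subset_leq_card; apply/fintype.subsetP => -[[[x y] z] [[x' y'] z']]; rewrite !inE /= => /andP[/eqP k h].
have h' : deg (x', y', z').
  have := key3_prod k; rewrite /deg /=; move: h; rewrite /deg /= => /orP[]/eqP->;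
    rewrite subrr ?mul0r ?mulr0 => /esym/eqP; rewrite mulf_eq0 !subr_eq0 !eqz_nat;
    by rewrite -!val_eqE /= ![_ == nat_of_ord z']eq_sym.
have [e1 _] := k.
apply/imsetP.
case/orP: h => /eqP /= e; case/orP: h' => /eqP /= e'; subst; rewrite ?addrK in e1.
- exists (true, true, (x, z, z')) => //; rewrite /g /mk /=.
  by rewrite (_ : x = x') //; apply: ord_inj; lia.
- exists (true, false, (x, z, z')) => //; rewrite /g /mk /=.
  by rewrite (_ : x = y') //; apply: ord_inj; lia.
- exists (false, true, (y, z, z')) => //; rewrite /g /mk /=.
  by rewrite (_ : y = x') //; apply: ord_inj; lia.
- exists (false, false, (y, z, z')) => //; rewrite /g /mk /=.
  by rewrite (_ : y = y') //; apply: ord_inj; lia.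
Qed.

(** With [2 * k] variables fixed, six remain in a shifted system. Moving one variable across from
    each side brings it to the form [x + y - z] of [key3], and [card_pairs_shift] removes the
    shift. *)
Lemma vinogradov_mean_value k D :
  (forall m, (0 < m)%N -> (m <= B ^ 2)%N -> (tau m <= D)%N) ->
  (#|[set pp : {ffun 'I_k.+3 -> 'I_B} * {ffun 'I_k.+3 -> 'I_B} |
       key pp.1 == key pp.2]| <= (2 * D + 4) * B ^ (2 * k + 3))%N.
Proof.
move=> hD; set S := [set _ | _].
pose T := ('I_B * 'I_B * 'I_B)%type.
pose rho := ({ffun 'I_k -> 'I_B} * {ffun 'I_k -> 'I_B})%type.
pose i0 : 'I_k.+3 := ord0.
pose i1 : 'I_k.+3 := lift ord0 ord0.
pose i2 : 'I_k.+3 := lift ord0 (lift ord0 ord0).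
pose rs (phi : {ffun 'I_k.+3 -> 'I_B}) : {ffun 'I_k -> 'I_B} :=
  [ffun i => phi (lift ord0 (lift ord0 (lift ord0 i)))].
pose h (pp : {ffun 'I_k.+3 -> 'I_B} * {ffun 'I_k.+3 -> 'I_B}) : rho * (T * T) :=
  ((rs pp.1, rs pp.2),
   ((pp.1 i0, pp.1 i1, pp.2 i0), (pp.2 i1, pp.2 i2, pp.1 i2))).
have ffE (phi psi : {ffun 'I_k.+3 -> 'I_B}) : phi i0 = psi i0 -> phi i1 = psi i1 ->
    phi i2 = psi i2 -> rs phi = rs psi -> phi = psi.
  move=> e0 e1 e2 er; apply/ffunP => i.
  case: (unliftP ord0 i) => [j ->|-> //]; case: (unliftP ord0 j) => [l ->|-> //].
  case: (unliftP ord0 l) => [m ->|-> //].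
  by have := congr1 (fun f : {ffun 'I_k -> 'I_B} => f m) er; rewrite !ffunE.
have hI : injective h.
  move=> [p1 p2] [p3 p4]; rewrite /h /= => -[] er1 er2 a1 a2 a3 a4 a5 a6.
  by rewrite (ffE p1 p3) // (ffE p2 p4).
rewrite -(card_imset (mem S) hI).
pose c (r : rho) : int * int := key r.2 - key r.1.
pose S' := [set w : rho * (T * T) | key3 w.2.1 == key3 w.2.2 + c w.1].
apply: (@leq_trans #|S'|).
  apply: subset_leq_card; apply/fintype.subsetP => _ /imsetP[[p1 p2] + ->]; rewrite !inE /=.
  rewrite /key /c /key /=.
  rewrite ![in X in X -> _]big_ord_recl /= => /eqP[e1 e2].
  rewrite /rs.
  have F1 (p : {ffun 'I_k.+3 -> 'I_B}) (g : nat -> int) :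
      \sum_(i < k) g ([ffun i : 'I_k => p (lift ord0 (lift ord0 (lift ord0 i)))] i) =
      \sum_(i < k) g (p (lift ord0 (lift ord0 (lift ord0 i)))).
    by apply: eq_bigr => i _; rewrite ffunE.
  rewrite (F1 p1 (fun n => n%:Z)) (F1 p2 (fun n => n%:Z)).
  rewrite (F1 p1 (fun n => n%:Z ^+ 2)) (F1 p2 (fun n => n%:Z ^+ 2)).
  have pairE (a b a' b' a'' b'' : int) :
    (a, b) + ((a', b') - (a'', b'')) = (a + (a' - a''), b + (b' - b'')) by [].
  rewrite pairE /i0 /i1 /i2; move: e1 e2.
  do 4! [move: (\sum_(i < k) _) => ?] => e1 e2.
  by apply/eqP; congr (_, _); lia.
rewrite card_pair_fibers.
apply: (@leq_trans (\sum_(r : rho) (2 * D + 4) * B ^ 3)); last first.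
  rewrite sum_nat_const card_prod !card_ffun !card_ord -expnD addnn -mul2n.
  by rewrite expnD mulnCA.
apply: leq_sum => r _.
apply: leq_trans (card_key3_pairs hD).
apply: leq_trans (card_pairs_shift key3 (c r)).
by apply: subset_leq_card; apply/fintype.subsetP => XY; rewrite !inE.
Qed.

End Vinogradov.

(** * Tuples in which every value is repeated *)

Section BadTuples.
Variables (r B : nat).

Definition joined (pp : {ffun 'I_r -> 'I_B} * {ffun 'I_r -> 'I_B}) (x : 'I_r + 'I_r) :=
  match x with inl i => pp.1 i | inr j => pp.2 j end.

Definition no_isolated pp :=
  [forall x, exists y, (y != x) && (joined pp y == joined pp x)].

(** If each value occurs at least twice among the [2 r] coordinates, there are at most [r] values: a
    pair is encoded by a list of [r] values and a labelling of the coordinates. *)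
Lemma card_no_isolated :
  (#|[set pp | no_isolated pp]| <= B ^ r * r ^ (r + r))%N.
Proof.
pose W := ({ffun 'I_r -> 'I_B} * {ffun ('I_r + 'I_r)%type -> 'I_r})%type.
have <- : #|{: W}| = (B ^ r * r ^ (r + r))%N.
  by rewrite card_prod !card_ffun !card_ord card_sum !card_ord.
pose g (w : W) : {ffun 'I_r -> 'I_B} * {ffun 'I_r -> 'I_B} :=
  ([ffun i => w.1 (w.2 (inl i))], [ffun i => w.1 (w.2 (inr i))]).
apply: leq_trans (leq_imset_card g (mem predT)).
apply: subset_leq_card; apply/fintype.subsetP => pp; rewrite inE => /forallP bad.
pose S := [set joined pp x | x : ('I_r + 'I_r)%type].
have cS : (#|S| <= r)%N.
  suff : (#|S| * 2 <= #|{: 'I_r + 'I_r}|)%N by rewrite card_sum !card_ord; lia.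
  rewrite -[X in (_ <= X)%N]sum1_card (partition_big (joined pp) (mem S)) /=; last first.
    by move=> x _; apply: imset_f.
  rewrite -sum_nat_const; apply: leq_sum => v /imsetP[x _ ->].
  rewrite sum1_card; have /existsP[y /andP[yx /eqP exy]] := bad x.
  apply: (@leq_trans #|[set x; y]|); first by rewrite cards2 eq_sym yx.
  apply: subset_leq_card; apply/fintype.subsetP => z; rewrite !inE => /orP[]/eqP->; by rewrite -topredE /= ?exy; apply/eqnP.
have lt x : (index (joined pp x) (enum S) < r)%N.
  apply: leq_trans cS; rewrite cardE index_mem mem_enum; exact: imset_f.
pose l : {ffun ('I_r + 'I_r)%type -> 'I_r} := [ffun x => Ordinal (lt x)].
(* For [r = 0] there is no coordinate from which to take the default [d] of [nth]. *)
have [r0|] := posnP r.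
  apply/imsetP; exists (pp.1, l) => //; rewrite /g /=.
  by case: pp bad @S cS lt @l => p1 p2 *; congr (_, _); apply/ffunP => i; have := ltn_ord i; rewrite {2}r0.
move=> r0; pose d := joined pp (inl (Ordinal r0)).
pose w : {ffun 'I_r -> 'I_B} := [ffun i : 'I_r => nth d (enum S) i].
have wl x : w (l x) = joined pp x.
  by rewrite !ffunE /= nth_index // mem_enum imset_f.
apply/imsetP; exists (w, l) => //; rewrite /g /=.
by case: pp {bad} @S cS lt @l @d @w wl => p1 p2 S cS lt l d w wl; congr (_, _); apply/ffunP => i; rewrite ffunE /= wl.
Qed.

End BadTuples.

(** * The moment of twisted sums *)

Section FiniteInequalities.
Variable R : realType.

Lemma cauchy_schwarz_sum (I : Type) (s : seq I) (a b : I -> R) :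
  (\sum_(i <- s) a i * b i) ^+ 2 <=
  (\sum_(i <- s) a i ^+ 2) * (\sum_(i <- s) b i ^+ 2).
Proof.
have h : 0 <= \sum_(i <- s) \sum_(j <- s) (a i * b j - a j * b i) ^+ 2.
  by apply: sumr_ge0 => i _; apply: sumr_ge0 => j _; apply: sqr_ge0.
have E : \sum_(i <- s) \sum_(j <- s) (a i * b j - a j * b i) ^+ 2 =
    2 * ((\sum_(i <- s) a i ^+ 2) * (\sum_(i <- s) b i ^+ 2)) -
    2 * (\sum_(i <- s) a i * b i) ^+ 2.
  transitivity (\sum_(i <- s) \sum_(j <- s) (a i ^+ 2 * b j ^+ 2 + a j ^+ 2 * b i ^+ 2
                 - 2 * (a i * b i * (a j * b j)))).
    by apply: eq_bigr => i _; apply: eq_bigr => j _; ring.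
  under eq_bigr do rewrite sumrB big_split /=.
  rewrite sumrB big_split /= [X in _ + X - _]exchange_big /=.
  have -> : \sum_(i <- s) \sum_(j <- s) a i ^+ 2 * b j ^+ 2 =
     (\sum_(i <- s) a i ^+ 2) * (\sum_(i <- s) b i ^+ 2).
    by rewrite big_distrl /=; apply: eq_bigr => i _; rewrite big_distrr.
  have -> : \sum_(i <- s) \sum_(j <- s) 2 * (a i * b i * (a j * b j)) =
     2 * (\sum_(i <- s) a i * b i) ^+ 2.
    rewrite expr2 big_distrl /= big_distrr /=; apply: eq_bigr => i _.
    by rewrite !big_distrr.
  ring.
move: h; rewrite E; lra.
Qed.

Lemma tangent_line_pow (z m : R) n : 0 <= z -> 0 <= m ->
  m ^+ n.+1 + n.+1%:R * m ^+ n * (z - m) <= z ^+ n.+1.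
Proof.
move=> z0 m0; elim: n => [|n IH]; first by rewrite expr0 !expr1; lra.
rewrite [z ^+ n.+2]exprS.
apply: le_trans (ler_wpM2l z0 IH).
rewrite -subr_ge0.
have -> : z * (m ^+ n.+1 + n.+1%:R * m ^+ n * (z - m)) -
   (m ^+ n.+2 + n.+2%:R * m ^+ n.+1 * (z - m)) = n.+1%:R * m ^+ n * (z - m) ^+ 2.
  by rewrite !exprS -[n.+2%:R]natr1; ring.
by rewrite mulr_ge0 ?sqr_ge0 // mulr_ge0 ?exprn_ge0.
Qed.

(** Convexity: the tangent inequality at the mean is summed over [I], and its linear part
    cancels. *)
Lemma power_mean (I : finType) (t : I -> R) n : (forall i, 0 <= t i) ->
  (\sum_i t i) ^+ n.+1 <= #|I|%:R ^+ n * \sum_i t i ^+ n.+1.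
Proof.
move=> t0; have [I0|I0] := posnP #|I|.
  rewrite !big1 ?expr0n ?mulr0 // => i _; exfalso; have := fintype0 i I0; done.
pose N : R := #|I|%:R; have N0 : 0 < N by rewrite ltr0n.
pose m := (\sum_i t i) / N.
have m0 : 0 <= m by rewrite divr_ge0 ?sumr_ge0 // ltW.
have mE : \sum_i t i = N * m by rewrite /m mulrCA divff ?mulr1 // gt_eqF.
have : \sum_i (m ^+ n.+1 + n.+1%:R * m ^+ n * (t i - m)) <= \sum_i t i ^+ n.+1.
  by apply: ler_sum => i _; apply: tangent_line_pow.
have cst (c : R) : \sum_(i : I) c = N * c by rewrite sumr_const mulr_natl.
rewrite big_split /= -big_distrr /= sumrB !cst mE subrr mulr0 addr0 => h.
rewrite exprMn exprSr -mulrA ler_wpM2l ?exprn_ge0 ?(ltW N0) //.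
Qed.

End FiniteInequalities.

Section Moment.
Variables (R : realType) (F : finFieldType) (q : nat) (chi : F -> R[i]).
Variables (r B : nat).
Hypotheses (q_prime : prime q) (cardF : #|F| = q) (pF : q \in [pchar F])
  (chi1 : chi 1 = 1) (chi0 : chi 0 = 0)
  (chiM : forall x y, chi (x * y) = chi x * chi y)
  (chi_nontrivial : exists2 b, b != 0 & chi b != 1)
  (extension : forall k, (0 < k)%N ->
    exists (K : finFieldType) (emb : {rmorphism F -> K}),
      q \in [pchar K] /\ #|K| = (q ^ k)%N)
  (r_gt0 : (0 < r)%N) (Bq : (B <= q)%N).

Lemma natr_inj_lt m n : (m < q)%N -> (n < q)%N -> m%:R = n%:R :> F -> m = n.
Proof.
wlog mn : m n / (m <= n)%N => [h hm hn e|hm hn e].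
  by case/orP: (leq_total m n) => ?; [|symmetry]; apply: h.
have : (n - m)%:R = 0 :> F by rewrite natrB // e subrr.
move/eqP; rewrite -(dvdn_pcharf pF) => /dvdn_leq; lia.
Qed.

(** Expresses a conjugate as a value of [chi] itself, so that a correlation is a single character
    sum of a polynomial, with multiplicity [q.-2] for the conjugated factors. *)
Lemma conj_chi y : (chi y)^* = chi (y ^+ q.-2).
Proof.
have q2 := p_gt2 q_prime cardF chi1 chi_nontrivial.
have [->|y0] := eqVneq y 0.
  have q20 : (q.-2 == 0)%N = false by lia.
  by rewrite chi0 conjc0 expr0n q20 mulr0n chi0.
have n1 := nm_chi q_prime cardF chi1 chiM y0.
have c0 : chi y != 0 by rewrite -nm_gt0 n1.
apply: (mulfI c0); rewrite mulc_conj n1 expr1n -chiM -exprS.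
have -> : q.-2.+1 = q.-1 by lia.
by rewrite -cardF finField_fermat // chi1.
Qed.

Definition Gprod (x : F) (phi : {ffun 'I_r -> 'I_B}) := \prod_i chi (x + (phi i)%:R).

Definition corr (pp : {ffun 'I_r -> 'I_B} * {ffun 'I_r -> 'I_B}) : R[i] :=
  \sum_x Gprod x pp.1 * (Gprod x pp.2)^*.

Lemma nm_corr_swap p1 p2 : nm (corr (p1, p2)) = nm (corr (p2, p1)).
Proof.
rewrite -nm_conj; congr nm; rewrite /corr /= rmorph_sum; apply: eq_bigr => x _.
by rewrite rmorphM /= conjcK mulrC.
Qed.

Lemma nm_Gprod_le1 x phi : nm (Gprod x phi) <= 1.
Proof.
rewrite nm_prod.
suff /andP[] : 0 <= \prod_i nm (chi (x + (phi i)%:R)) <= 1 by [].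
elim/big_ind: _ => [|a b /andP[a0 a1] /andP[b0 b1]|i _]; first by rewrite ler01 lexx.
  by rewrite mulr_ge0 // mulr_ile1.
by rewrite nm_ge0 (nm_chi_le1 q_prime cardF chi1 chi0 chiM).
Qed.

Lemma nm_corr_trivial pp : nm (corr pp) <= q%:R.
Proof.
apply: le_trans (nm_sum _ _ _) _; rewrite -cardF -sum1_card natr_sum.
apply: ler_sum => x _; rewrite nmM nm_conj.
by rewrite mulr_ile1 ?nm_ge0 ?nm_Gprod_le1.
Qed.

(** Translating [x] moves the isolated root to [0]. The other roots, with multiplicity [1] or
    [q.-2], form [as_], which avoids [0] because [B <= q] keeps distinct values distinct in [F].
    Only distinct roots count in [weil_bound], hence [r + r]. *)
Lemma nm_corr_isolated_left pp i0 :
  (forall y, y != inl i0 -> joined pp y != joined pp (inl i0)) ->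
  nm (corr pp) <= (r + r)%:R * Num.sqrt q%:R.
Proof.
move=> iso.
pose wt (y : 'I_r + 'I_r) := if y is inl _ then 1%N else q.-2.
pose c : F := (joined pp (inl i0))%:R.
pose as_ := flatten [seq nseq (wt y) ((joined pp y)%:R - c) |
                      y <- enum [pred y | y != inl i0]].
have as0 : 0 \notin as_.
  apply/negP => /flattenP[s /mapP[y]]; rewrite mem_enum inE => yi ->.
  rewrite mem_nseq => /andP[_]; rewrite eq_sym subr_eq0 => /eqP/natr_inj_lt.
  have lt (b : 'I_B) : (b < q)%N by apply: leq_trans Bq.
  move=> /(_ (lt _) (lt _)) h; have := iso y yi; by rewrite (val_inj h) eqxx.
have E : corr pp = \sum_x chi (x * \prod_(a <- as_) (a + x)).
  rewrite /corr (reindex (fun x => x - c)) /=; last first.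
    by apply/onW_bij; exists (fun x => x + c) => x; rewrite ?subrK ?addrK.
  apply: eq_bigr => x _; rewrite /Gprod rmorph_prod /=.
  transitivity (\prod_(y : 'I_r + 'I_r) chi ((x - c + (joined pp y)%:R) ^+ wt y)).
    rewrite big_sumType /=; congr (_ * _); apply: eq_bigr => i _ //.
    exact: conj_chi.
  rewrite (bigD1 (inl i0)) //= ?expr1 subrK chiM; congr (_ * _).
  rewrite (big_morph chi chiM chi1) /as_ big_flatten /= big_map big_enum /=.
  apply: eq_big => // y _; rewrite big_nseq iter_mulr_1 (chiX chi1 chiM); congr (chi _ ^+ _).
  by rewrite addrC addrA addrAC.
rewrite E.
apply: le_trans (weil_bound q_prime cardF chi1 chi0 chiM chi_nontrivial as0 extension) _.
rewrite ler_wpM2r ?sqrtr_ge0 // ler_nat.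
apply: (@leq_trans (size [seq ((joined pp y)%:R - c : F) | y <- enum {: 'I_r + 'I_r}])).
  apply: uniq_leq_size; first exact: undup_uniq.
  move=> a; rewrite mem_undup => /flattenP[s /mapP[y _ ->]].
  by rewrite mem_nseq => /andP[_ /eqP->]; apply: map_f; rewrite mem_enum.
by rewrite size_map -cardE card_sum !card_ord.
Qed.

Lemma nm_corr_isolated pp : ~~ no_isolated pp ->
  nm (corr pp) <= (r + r)%:R * Num.sqrt q%:R.
Proof.
case: pp => p1 p2; rewrite negb_forall => /existsP[x].
rewrite negb_exists => /forallP h.
have {}h y : y != x -> joined (p1, p2) y != joined (p1, p2) x.
  by move=> yx; have := h y; rewrite yx.
case: x h => i h; first exact: nm_corr_isolated_left h.
rewrite nm_corr_swap; apply: (@nm_corr_isolated_left _ i) => -[j|j] ji /=.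
  by have := h (inr j) ji.
by have := h (inl j) isT.
Qed.

Lemma sum_ltn_mul n (f : 'I_n -> nat) M : (0 < n)%N ->
  (forall i, f i < M)%N -> (\sum_i f i < n * M)%N.
Proof.
move=> n0 fM; have : (\sum_i (f i + 1) <= \sum_(i < n) M)%N.
  by apply: leq_sum => i _; rewrite addn1 fM.
rewrite big_split /= sum1_card sum_nat_const card_ord; lia.
Qed.

(** A box containing all keys; its size [r^2 B^3] is the number of frequencies. *)
Definition keys : seq (int * int) :=
  [seq (a%:Z, b%:Z) | a <- iota 0 (r * B), b <- iota 0 (r * B ^ 2)].

Lemma keys_uniq : uniq keys.
Proof. by rewrite allpairs_uniq ?iota_uniq // => -[a b] [c d] _ _ [-> ->]. Qed.

Lemma key_in_keys (phi : {ffun 'I_r -> 'I_B}) : key phi \in keys.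
Proof.
rewrite /key /keys.
have -> : \sum_i (phi i)%:Z = (\sum_i (phi i : nat))%N%:Z by rewrite (big_morph Posz PoszD (erefl _)).
have -> : \sum_i (phi i)%:Z ^+ 2 = (\sum_i (phi i ^ 2))%N%:Z.
  rewrite (big_morph Posz PoszD (erefl _)); apply: eq_bigr => i _.
  by rewrite -mulnn PoszM expr2.
apply: allpairs_f; rewrite mem_iota add0n /=.
  by apply: sum_ltn_mul => // i; apply: ltn_ord.
by apply: sum_ltn_mul => // i; rewrite ltn_exp2r.
Qed.

Definition Wkey x v := \sum_(phi | key phi == v) Gprod x phi.

(** Free of the phase; [VrE] rewrites it as a sum over the solutions of the Vinogradov system. *)
Definition Vr x : R := \sum_(v <- keys) nm (Wkey x v) ^+ 2.

Lemma Vr_ge0 x : 0 <= Vr x.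
Proof. by apply: sumr_ge0 => v _; rewrite exprn_ge0 ?nm_ge0. Qed.

Lemma VrE x : (Vr x)%:C = \sum_(pp | key pp.1 == key pp.2) Gprod x pp.1 * (Gprod x pp.2)^*.
Proof.
rewrite /Vr rmorph_sum /=.
transitivity (\sum_(v <- keys) \sum_(p1 | key p1 == v) \sum_(p2 | key p2 == v)
    Gprod x p1 * (Gprod x p2)^*).
  apply: eq_bigr => v _; rewrite -mulc_conj /Wkey rmorph_sum big_distrl /=.
  by apply: eq_bigr => p1 _; rewrite big_distrr.
transitivity (\sum_p1 \sum_(v <- keys | key p1 == v) \sum_(p2 | key p2 == v)
    Gprod x p1 * (Gprod x p2)^*).
  by rewrite (exchange_big_dep predT).
rewrite -(pair_big_dep predT (fun p1 p2 => key p1 == key p2)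
   (fun p1 p2 => Gprod x p1 * (Gprod x p2)^*)) /=.
apply: eq_bigr => p1 _.
rewrite -big_filter (_ : [seq v <- keys | key p1 == v] = [:: key p1]) ?big_seq1.
  by apply: eq_bigl => p2; rewrite eq_sym.
rewrite (eq_filter (a2 := pred1 (key p1))) => [|v]; last by rewrite /= eq_sym.
by rewrite filter_pred1_uniq ?keys_uniq ?key_in_keys.
Qed.

(** Pairs without an isolated coordinate are few and get the trivial bound [q]; every other solution
    gets Weil's bound. *)
Lemma sum_Vr_bound J :
  (#|[set pp : {ffun 'I_r -> 'I_B} * {ffun 'I_r -> 'I_B} | key pp.1 == key pp.2]| <= J)%N ->
  \sum_x Vr x <= (B ^ r * r ^ (r + r))%:R * q%:R + J%:R * ((r + r)%:R * Num.sqrt q%:R).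
Proof.
move=> hJ.
have -> : \sum_x Vr x = nm (\sum_(pp | key pp.1 == key pp.2) corr pp).
  have -> : \sum_(pp | key pp.1 == key pp.2) corr pp = (\sum_x Vr x)%:C.
    rewrite /corr exchange_big rmorph_sum; apply: eq_bigr => x _ /=.
    by rewrite VrE.
  by apply: complexI; rewrite -nmE ger0_norm // ler0c sumr_ge0 // => x _; rewrite Vr_ge0.
apply: le_trans (nm_sum _ _ _) _.
rewrite (bigID (fun pp => no_isolated pp)) /=; apply: lerD.
  apply: le_trans (ler_sum _ (fun pp _ => nm_corr_trivial pp)) _.
  rewrite sumr_const -[_ *+ _]mulr_natl ler_wpM2r ?ler0n // ler_nat.
  apply: leq_trans (card_no_isolated r B); apply: subset_leq_card.
  by apply/fintype.subsetP => pp; rewrite !inE -topredE /= => /andP[].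
apply: le_trans (ler_sum _ (_ : forall pp, _ -> nm (corr pp) <= (r + r)%:R * Num.sqrt q%:R)) _.
  by move=> pp /andP[_ /nm_corr_isolated].
rewrite sumr_const -[_ *+ _]mulr_natl ler_wpM2r ?mulr_ge0 ?sqrtr_ge0 ?ler0n // ler_nat.
apply: leq_trans hJ; apply: subset_leq_card.
by apply/fintype.subsetP => pp; rewrite !inE -topredE /= => /andP[].
Qed.

(* The [r]-th power of the sum is a trigonometric polynomial with at most
   [r^2 B^3] frequencies, the keys, so Cauchy-Schwarz bounds it uniformly in
   the coefficients of the phase. *)
Lemma twisted_sum_pow_le (x : F) (eps : 'I_B -> R[i]) (E : int * int -> R[i]) :
  (forall v, nm (E v) <= 1) ->
  (forall phi : {ffun 'I_r -> 'I_B}, \prod_i eps (phi i) = E (key phi)) ->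
  nm (\sum_b eps b * chi (x + b%:R)) ^+ (2 * r) <= (r ^ 2 * B ^ 3)%:R * Vr x.
Proof.
move=> E1 hE.
have -> : nm (\sum_b eps b * chi (x + b%:R)) ^+ (2 * r) =
  nm (\sum_(v <- keys) E v * Wkey x v) ^+ 2.
  rewrite mulnC exprM -nmX; congr (nm _ ^+ 2).
  rewrite -[in LHS](card_ord r) -prodr_const bigA_distr_bigA /=.
  transitivity (\sum_(phi : {ffun 'I_r -> 'I_B}) E (key phi) * Gprod x phi).
    by apply: eq_bigr => phi _; rewrite big_split /= hE.
  transitivity (\sum_(phi : {ffun 'I_r -> 'I_B}) \sum_(v <- keys | key phi == v) E v * Gprod x phi).
    apply: eq_bigr => phi _.
    rewrite -big_filter (_ : [seq v <- keys | key phi == v] = [:: key phi]) ?big_seq1 //.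
    rewrite (eq_filter (a2 := pred1 (key phi))) => [|v]; last by rewrite /= eq_sym.
    by rewrite filter_pred1_uniq ?keys_uniq ?key_in_keys.
  rewrite (exchange_big_dep predT) //=; apply: eq_bigr => v _.
  by rewrite /Wkey big_distrr.
apply: (@le_trans _ _ ((\sum_(v <- keys) 1 * nm (Wkey x v)) ^+ 2)).
  apply: lerXn2r; rewrite ?nnegrE ?nm_ge0 ?sumr_ge0 //.
    by move=> v _; rewrite mul1r nm_ge0.
  apply: le_trans (nm_sum _ _ _) _; apply: ler_sum => v _.
  by rewrite nmM ler_wpM2r ?nm_ge0.
apply: le_trans (cauchy_schwarz_sum _ _ _) _.
rewrite ler_wpM2r ?Vr_ge0 //.
rewrite big_const_seq count_predT iter_addr_0 expr1n size_allpairs !size_iota.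
by rewrite ler_nat; apply: eq_leq; ring.
Qed.

End Moment.

(** * Multiplicities of the quotients n / a *)

Section Multiplicities.

Lemma card_set_sum (T : finType) (P : pred T) : #|[set x | P x]| = (\sum_x P x)%N.
Proof.
by rewrite -sum1_card big_mkcond; apply: eq_bigr => x _; rewrite inE; case: (P x).
Qed.

Lemma card_residue_class n d (S : {set 'I_n}) : (0 < d)%N ->
  {in S &, forall i j : 'I_n, i = j %[mod d]} -> (#|S| <= (n %/ d).+1)%N.
Proof.
move=> d0 hS.
pose f (i : 'I_n) : 'I_(n %/ d).+1 := inord (i %/ d).
have fv (i : 'I_n) : f i = (i %/ d)%N :> nat.
  by rewrite inordK // ltnS leq_div2r // ltnW.
have fI : {in S &, injective f}.
  move=> i j iS jS e; apply: ord_inj.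
  rewrite (divn_eq i d) (divn_eq j d) (hS i j) //; congr (_ * _ + _)%N.
  by rewrite -!fv e.
rewrite -(card_in_imset fI) -[X in (_ <= X)%N]card_ord; exact: max_card.
Qed.

(** The gcd is at most the sum of the common divisors. A divisor [d <= 2 * A] of [a] contributes at
    most [d * (A / d + 1) <= 3 * A]. *)
Lemma sum_gcdn_le A a D : (0 < a)%N -> (a <= 2 * A)%N -> (tau a <= D)%N ->
  (\sum_(i < A) gcdn a (A.+1 + i) <= 3 * A * D)%N.
Proof.
move=> a0 aA hD.
have step (i : 'I_A) : (gcdn a (A.+1 + i) <= \sum_(d <- divisors a) d * (d %| A.+1 + i))%N.
  rewrite (bigD1_seq (gcdn a (A.+1 + i))) ?divisors_uniq //=; last first.
    by rewrite -dvdn_divisors // dvdn_gcdl.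
  by rewrite dvdn_gcdr muln1 leq_addr.
apply: leq_trans (leq_sum _ (fun i _ => step i)) _.
rewrite exchange_big /=.
apply: (@leq_trans (\sum_(d <- divisors a) 3 * A)%N); last first.
  by rewrite big_const_seq count_predT iter_addn_0 leq_mul2l hD orbT.
rewrite big_seq [X in (_ <= X)%N]big_seq; apply: leq_sum => d.
rewrite -dvdn_divisors // => da.
have d0 : (0 < d)%N by apply: dvdn_gt0 da.
have dA : (d <= 2 * A)%N by apply: leq_trans aA; apply: dvdn_leq.
rewrite -big_distrr /=.
have -> : (\sum_(i < A) (d %| A.+1 + i) = #|[set i : 'I_A | d %| A.+1 + i]|)%N.
  by rewrite -sum1_card [RHS]big_mkcond /=; apply: eq_bigr => i _; rewrite inE; case: (d %| _)%N.
have h : (#|[set i : 'I_A | d %| A.+1 + i]| <= (A %/ d).+1)%N.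
  apply: card_residue_class => // i j; rewrite !inE => /eqP hi /eqP hj.
  by apply/eqP; rewrite -(eqn_modDl A.+1) hi hj.
apply: (@leq_trans (d * (A %/ d).+1)); first by rewrite leq_mul2l h orbT.
by rewrite mulnS mulnC; have := leq_divM A d; lia.
Qed.

Variables (q : nat) (F : finFieldType).
Hypotheses (q_prime : prime q) (pF : q \in [pchar F]).

Lemma intr_eq0_dvdz (n : int) : (n%:~R == 0 :> F) = (q%:Z %| n)%Z.
Proof.
rewrite dvdzE /= (dvdn_pcharf pF); case: n => n /=; first by rewrite -pmulrn.
by rewrite NegzE mulrNz oppr_eq0 -pmulrn.
Qed.

Definition quot (A H : nat) (N : int) (p : 'I_A * 'I_H) : F :=
  (N + p.2%:Z)%:~R / (A.+1 + p.1)%:R.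

(** The difference of two solutions no longer involves [N], and [4 * A * H <= q] turns its
    congruence into an equality of integers. So the first coordinate determines the second and is
    fixed modulo [a / gcd(a, a')]. *)
Lemma card_quot_fiber A H N (i i' : 'I_A) : (4 * A * H <= q)%N ->
  (A * #|[set hh : 'I_H * 'I_H | quot N (i, hh.1) == quot N (i', hh.2)]| <=
   H * gcdn (A.+1 + i) (A.+1 + i') + A)%N.
Proof.
move=> AHq.
set a := (A.+1 + i)%N; set a' := (A.+1 + i')%N; set S := [set _ | _].
have [H0|H0] := posnP H.
  by rewrite (_ : #|S| = 0%N) ?muln0 //; apply: eq_card0 => -[h ?]; have := ltn_ord h; rewrite {2}H0.
have iA := ltn_ord i; have i'A := ltn_ord i'.
have A0 : (0 < A)%N by lia.
have aq : (0 < a < q)%N by rewrite /a; nia.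
have a'q : (0 < a' < q)%N by rewrite /a'; nia.
have nz n : (0 < n < q)%N -> n%:R != 0 :> F.
  by move=> /andP[n0 nq]; rewrite -(dvdn_pcharf pF); apply/negP => /dvdn_leq; lia.
have SE hh : hh \in S -> (q%:Z %| a'%:Z * (N + hh.1%:Z) - a%:Z * (N + hh.2%:Z))%Z.
  rewrite inE /quot /= -/a -/a' eqr_div ?nz // => e.
  rewrite -intr_eq0_dvdz rmorphB !rmorphM /= -!pmulrn subr_eq0.
  by rewrite mulrC (eqP e) mulrC.
have lin h1 h2 : h1 \in S -> h2 \in S ->
    (a%:Z * (h1.2%:Z - h2.2%:Z) = a'%:Z * (h1.1%:Z - h2.1%:Z)).
  move=> /SE d1 /SE d2.
  have d3 : (q%:Z %| a'%:Z * (h1.1%:Z - h2.1%:Z) - a%:Z * (h1.2%:Z - h2.2%:Z))%Z.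
    have -> : a'%:Z * (h1.1%:Z - h2.1%:Z) - a%:Z * (h1.2%:Z - h2.2%:Z) =
      (a'%:Z * (N + h1.1%:Z) - a%:Z * (N + h1.2%:Z)) -
      (a'%:Z * (N + h2.1%:Z) - a%:Z * (N + h2.2%:Z)) by ring.
    by rewrite rpredB.
  apply/eqP; rewrite eq_sym -subr_eq0; apply: contraT => z0.
  have := dvdn_leq (_ : 0 < absz _)%N d3; rewrite absz_gt0 z0 => /(_ isT) /=.
  have b1 := ltn_ord h1.1; have b2 := ltn_ord h1.2; have b3 := ltn_ord h2.1; have b4 := ltn_ord h2.2.
  have a2 : (a <= 2 * A)%N by rewrite /a; lia.
  have a'2 : (a' <= 2 * A)%N by rewrite /a'; lia.
  have bnd (c : nat) (x y : 'I_H) : (c <= 2 * A)%N -> (absz (c%:Z * (x%:Z - y%:Z))%R <= 2 * A * H.-1)%N.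
    by move=> hc; rewrite abszM; apply: leq_mul => //; have := ltn_ord x; have := ltn_ord y; lia.
  have := bnd a' h1.1 h2.1 a'2; have := bnd a h1.2 h2.2 a2.
  have : (4 * A * H.-1 < q)%N by apply: leq_trans AHq; rewrite ltn_pmul2l ?muln_gt0 //; lia.
  have -> : (4 * A * H.-1 = 2 * A * H.-1 + 2 * A * H.-1)%N by ring.
  move: (2 * A * H.-1)%N (a%:Z * (h1.2%:Z - h2.2%:Z)) (a'%:Z * (h1.1%:Z - h2.1%:Z)).
  by clear; move=> w u v; lia.
pose g := gcdn a a'; pose m := (a %/ g)%N.
have a0 : (0 < a)%N by case/andP: aq.
have g0 : (0 < g)%N by rewrite gcdn_gt0 a0.
have aE : a = (m * g)%N by rewrite divnK // dvdn_gcdl.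
have m0 : (0 < m)%N by rewrite lt0n; apply/eqP => e; rewrite e mul0n in aE; rewrite aE in a0.
have fI : {in S &, injective (fun hh : 'I_H * 'I_H => hh.1)}.
  move=> [h1 h1'] [h2 h2'] s1 s2 /= e; rewrite e; congr (_, _); apply: ord_inj.
  have := lin _ _ s1 s2; rewrite /= e subrr mulr0 => /eqP; rewrite mulf_eq0 subr_eq0 eqz_nat.
  by rewrite eqz_nat gtn_eqF //= => /eqP.
have cS : (#|S| <= (H %/ m).+1)%N.
  rewrite -(card_in_imset fI); apply: card_residue_class => // _ _ /imsetP[h1 s1 ->] /imsetP[h2 s2 ->].
  have e := lin _ _ s1 s2.
  have dv : (m%:Z %| h1.1%:Z - h2.1%:Z)%Z.
    have cp : coprimez m%:Z (a' %/ g)%N%:Z.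
      by rewrite coprimezE /= /m /g /coprime -(@eqn_pmul2l g) // muln1 muln_gcdr ![(gcdn a a' * _)%N]mulnC !divnK ?dvdn_gcdl ?dvdn_gcdr.
    rewrite -(Gauss_dvdzr _ cp); apply/dvdzP; exists (h1.2%:Z - h2.2%:Z).
    apply: (mulfI (_ : g%:Z != 0)); first by rewrite eqz_nat gtn_eqF.
    move: e; rewrite {1}aE -{1}(divnK (dvdn_gcdr a a')) -/g !PoszM => e.
    by rewrite mulrA [g%:Z * _]mulrC -e; ring.
  by apply/eqP; move: dv; rewrite -eqz_mod_dvd !modz_nat eqz_nat.
have e1 : (A * (H %/ m) <= H * g)%N.
  apply: (@leq_trans (m * g * (H %/ m))); first by rewrite leq_mul2r -aE /a; apply/orP; right; lia.
  by rewrite mulnAC leq_mul2r mulnC leq_divM orbT.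
by apply: (@leq_trans (A * (H %/ m).+1)); rewrite ?leq_mul2l ?cS ?orbT // mulnS addnC leq_add2r.
Qed.

Lemma card_quot_pairs A H N D : (0 < A)%N -> (4 * A * H <= q)%N ->
  (forall m, (0 < m)%N -> (m <= 2 * A)%N -> (tau m <= D)%N) ->
  (#|[set pp : ('I_A * 'I_H) * ('I_A * 'I_H) | quot N pp.1 == quot N pp.2]| <=
   A ^ 2 + 3 * A * H * D)%N.
Proof.
move=> A0 AHq hD; set S := [set _ | _].
rewrite -(leq_pmul2l A0).
have -> : #|S| = (\sum_(i < A) \sum_(i' < A)
   #|[set hh : 'I_H * 'I_H | quot N (i, hh.1) == quot N (i', hh.2)]|)%N.
  rewrite /S card_set_sum -(pair_bigA _ (fun p p' => (quot N p == quot N p') : nat)) /=.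
  rewrite -(pair_bigA _ (fun i h => \sum_p' (quot N (i, h) == quot N p'))%N) /=.
  apply: eq_bigr => i _.
  transitivity (\sum_(h < H) \sum_(i' < A) \sum_(h' < H) (quot N (i, h) == quot N (i', h')))%N.
    by apply: eq_bigr => h _; rewrite pair_bigA; apply: eq_bigr => -[].
  rewrite exchange_big /=; apply: eq_bigr => i' _.
  by rewrite card_set_sum pair_bigA.
rewrite big_distrr /=.
apply: (@leq_trans (\sum_(i < A) (H * (3 * A * D) + A * A))); last first.
  by rewrite sum_nat_const card_ord; apply: eq_leq; ring.
apply: leq_sum => i _; rewrite big_distrr /=.
apply: leq_trans (leq_sum _ (fun i' _ => @card_quot_fiber A H N i i' AHq)) _.
rewrite big_split /= sum_nat_const card_ord leq_add2r -big_distrr /= leq_mul2l.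
apply/orP; right; have iA := ltn_ord i; apply: sum_gcdn_le; rewrite ?hD //; lia.
Qed.

End Multiplicities.

(** * Burgess's shifts *)

Section Phase.
Variable R : realType.

Lemma eD (s t : R) : e (s + t) = e s * e t.
Proof.
rewrite /e mulrDr cosD sinD; apply/eqP; rewrite eq_complex /=; apply/andP; split; apply/eqP; ring.
Qed.

Lemma e0 : e (0 : R) = 1.
Proof. by rewrite /e mulr0 cos0 sin0. Qed.

Lemma nm_e (t : R) : nm (e t) = 1.
Proof. by rewrite /nm normc_def /e /= cos2Dsin2 sqrtr1. Qed.

Lemma e_sum (I : finType) (f : I -> R) : e (\sum_i f i) = \prod_i e (f i).
Proof. by rewrite (big_morph _ eD e0). Qed.

Lemma horner_size3 (f : {poly R}) x : (size f <= 3)%N ->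
  f.[x] = f`_0 + f`_1 * x + f`_2 * x ^+ 2.
Proof.
move=> sf; rewrite (horner_coef_wide _ sf) !big_ord_recl big_ord0 /= expr0 mulr1 addr0.
by rewrite /bump /= addrA.
Qed.

End Phase.

Section WindowSums.
Variables (R : realType) (chi : int -> R[i]) (f : {poly R}).

Definition term n : R[i] := e f.[n%:~R] * chi n.

Definition isum N H := \sum_(h < H) term (N + h%:Z).

Lemma isum_shift N H c :
  isum N H = isum (N + c%:Z) H + isum N c - isum (N + H%:Z) c.
Proof.
have h N' a b : isum N' (a + b) = isum N' a + isum (N' + a%:Z) b.
  rewrite /isum big_split_ord /=; congr (_ + _); apply: eq_bigr => i _.
  by rewrite PoszD addrA.
apply/eqP; rewrite eq_sym subr_eq -h addnC addrC -h.
done.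
Qed.

Definition window_sum A B H N (p : 'I_A * 'I_H) : R[i] :=
  \sum_(b < B) term (N + p.2%:Z + ((A.+1 + p.1) * b)%:Z).

Lemma sum_const2 (C : pzRingType) (z : C) A B :
  \sum_(i < A) \sum_(b < B) z = (A * B)%:R * z.
Proof.
under eq_bigr do rewrite sumr_const.
by rewrite sumr_const !card_ord -mulrnA mulr_natl mulnC.
Qed.

(** [isum_shift] is averaged over the [A * B] shifts [a b]; each leaves two sums of length at most
    [2 * A * B], whence [2 * T]. *)
Lemma isum_window_bound A B H N (T : R) : (0 < A)%N -> (0 < B)%N ->
  (forall N' H', (H' <= 2 * A * B)%N -> nm (isum N' H') <= T) ->
  nm (isum N H) <= (\sum_p nm (@window_sum A B H N p)) / (A * B)%:R + 2 * T.
Proof.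
move=> A0 B0 hT.
have AB0 : 0 < (A * B)%:R :> R by rewrite ltr0n muln_gt0 A0.
rewrite -(ler_pM2l AB0) mulrDr mulrCA divff ?gt_eqF // mulr1.
rewrite -{1}(nm_nat R (A * B)) -nmM.
have -> : (A * B)%:R * isum N H = \sum_p @window_sum A B H N p +
   \sum_(i < A) \sum_(b < B) (isum N ((A.+1 + i) * b) - isum (N + H%:Z) ((A.+1 + i) * b)).
  rewrite /window_sum.
  rewrite -(pair_bigA _ (fun (i : 'I_A) (h : 'I_H) =>
    \sum_(b < B) term (N + h%:Z + ((A.+1 + i) * b)%:Z))) /=.
  rewrite -sum_const2 -big_split /=; apply: eq_bigr => i _.
  rewrite [X in _ = X + _]exchange_big -big_split /=; apply: eq_bigr => b _.
  rewrite (isum_shift N H ((A.+1 + i) * b)) -addrA; congr (_ + _).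
  by apply: eq_bigr => h _; rewrite addrAC.
apply: le_trans (nmD _ _) _; apply: lerD; first exact: nm_sum.
apply: le_trans (nm_sum _ _ _) _.
have -> : (A * B)%:R * (2 * T) = \sum_(i < A) \sum_(b < B) (2 * T).
  by rewrite sum_const2.
apply: ler_sum => i _; apply: le_trans (nm_sum _ _ _) _.
apply: ler_sum => b _; apply: le_trans (nmD _ _) _; rewrite nmN.
have hb : ((A.+1 + i) * b <= 2 * A * B)%N.
  by apply: leq_mul; [have := ltn_ord i; lia | apply: ltnW].
have := hT N _ hb; have := hT (N + H%:Z) _ hb; lra.
Qed.

End WindowSums.

Section Burgess.
Variables (R : realType) (F : finFieldType) (q : nat) (chiF : F -> R[i]).
Variables (chi : int -> R[i]) (f : {poly R}).
Hypotheses (q_prime : prime q) (cardF : #|F| = q) (pF : q \in [pchar F])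
  (chi1 : chiF 1 = 1) (chi0 : chiF 0 = 0)
  (chiM : forall x y, chiF (x * y) = chiF x * chiF y)
  (chi_nontrivial : exists2 b, b != 0 & chiF b != 1)
  (extension : forall k, (0 < k)%N ->
    exists (K : finFieldType) (emb : {rmorphism F -> K}),
      q \in [pchar K] /\ #|K| = (q ^ k)%N)
  (chiE : forall n, chi n = chiF n%:~R) (sf : (size f <= 3)%N).

(** Up to the factor [chiF a] of norm [1], the window sum is a twisted sum at [quot F N p]. A
    product of [r] of its phases depends on [phi] only through [key phi], which is the role of
    [E]. *)
Lemma window_sum_pow_le r A B H N p : (0 < r)%N -> (B <= q)%N -> (2 * A < q)%N ->
  nm (@window_sum R chi f A B H N p) ^+ (2 * r) <=
  (r ^ 2 * B ^ 3)%:R * Vr chiF r B (quot F N p).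
Proof.
move=> r0 Bq Aq.
set a := (A.+1 + p.1)%N; set n := N + p.2%:Z.
have aq : (0 < a < q)%N by rewrite /a; have := ltn_ord p.1; lia.
have a0 : a%:R != 0 :> F.
  by case/andP: aq => a0 aq; rewrite -(dvdn_pcharf pF); apply/negP => /dvdn_leq; lia.
pose g : R := f`_0 + f`_1 * n%:~R + f`_2 * n%:~R ^+ 2.
pose be : R := f`_1 * a%:R + 2 * f`_2 * n%:~R * a%:R.
pose al : R := f`_2 * a%:R ^+ 2.
pose eps (b : 'I_B) := e (g + be * b%:R + al * b%:R ^+ 2).
have -> : nm (@window_sum R chi f A B H N p) = nm (\sum_(b < B) eps b * chiF (quot F N p + b%:R)).
  rewrite -[RHS]mul1r -(nm_chi q_prime cardF chi1 chiM a0) -nmM; congr nm.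
  rewrite big_distrr /=; apply: eq_bigr => b _.
  rewrite /term mulrCA; congr (_ * _).
    rewrite (horner_size3 _ sf) /eps; congr e.
    by rewrite /g /be /al -/a -/n rmorphD /= -pmulrn natrM; ring.
  rewrite chiE -chiM; congr chiF.
  rewrite /quot -/a -/n mulrDr mulrCA divff // mulr1 rmorphD /= -pmulrn natrM.
  done.
clearbody g be al.
pose E (v : int * int) := e (r%:R * g + be * v.1%:~R + al * v.2%:~R).
apply: (@twisted_sum_pow_le R F q chiF r B q_prime cardF pF r0 Bq _ eps E).
  by move=> v; rewrite /E nm_e.
move=> phi; rewrite -e_sum /E /key /=; congr e.
rewrite !big_split /= sumr_const card_ord mulr_natl -!big_distrr /= !rmorph_sum /=.
congr (_ + be * _ + al * _); apply: eq_bigr => i _; by rewrite ?rmorphXn /= -pmulrn.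
Qed.

(** Hoelder's inequality in two steps: a power mean with exponent [r] over the pairs [(a, n)], then
    Cauchy-Schwarz over the residues. The squared multiplicities count pairs with equal
    quotients. *)
Lemma burgess_moment r A B H N NU (VS : R) : (0 < r)%N -> (B <= q)%N -> (2 * A < q)%N ->
  (#|[set pp : ('I_A * 'I_H) * ('I_A * 'I_H) | quot F N pp.1 == quot F N pp.2]| <= NU)%N ->
  \sum_x Vr chiF r B x <= VS ->
  (\sum_p nm (@window_sum R chi f A B H N p)) ^+ (2 * r) <=
  (A * H)%:R ^+ (2 * r.-1) * (NU%:R * ((r ^ 2 * B ^ 3)%:R * VS)).
Proof.
case: r => // r _ Bq Aq hNU hVS.
pose t p := nm (@window_sum R chi f A B H N p).
have t0 p : 0 <= t p by apply: nm_ge0.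
pose c : R := (r.+1 ^ 2 * B ^ 3)%:R.
pose w x := Num.sqrt (c * Vr chiF r.+1 B x).
have cV x : 0 <= c * Vr chiF r.+1 B x by rewrite mulr_ge0 ?ler0n // Vr_ge0.
have tw p : t p ^+ r.+1 <= w (quot F N p).
  rewrite -(ler_pXn2r (_ : 0 < 2)%N) ?nnegrE ?exprn_ge0 ?sqrtr_ge0 // sqr_sqrtr //.
  by rewrite -exprM mulnC; apply: window_sum_pow_le.
have h1 := power_mean r t0.
rewrite card_prod !card_ord in h1.
rewrite mulnC exprM.
apply: (@le_trans _ _ (((A * H)%:R ^+ r * \sum_p t p ^+ r.+1) ^+ 2)).
  have s0 : 0 <= \sum_p t p by apply: sumr_ge0.
  have s1 := exprn_ge0 r.+1 s0.
  by apply: lerXn2r; rewrite ?nnegrE // (le_trans s1).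
rewrite exprMn -exprM (mulnC r 2) /= ler_wpM2l ?exprn_ge0 ?ler0n //.
apply: (@le_trans _ _ ((\sum_(x <- enum F) #|[set p | quot F N p == x]|%:R * w x) ^+ 2)).
  apply: lerXn2r; rewrite ?nnegrE ?sumr_ge0 //.
  - by move=> p _; rewrite exprn_ge0.
  - by move=> x _; rewrite mulr_ge0 ?sqrtr_ge0.
  apply: le_trans (ler_sum _ (fun p _ => tw p)) _.
  rewrite (partition_big (quot F N) predT) //= big_enum /=; apply: ler_sum => x _.
  rewrite (eq_bigr (fun=> w x)) => [|p /eqP-> //]; rewrite sumr_const mulr_natl.
  rewrite le_eqVlt; apply/orP; left; apply/eqP; congr (_ *+ _).
  by apply: eq_card => p; rewrite inE.
apply: le_trans (cauchy_schwarz_sum _ _ _) _.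
have w2 : \sum_(x <- enum F) w x ^+ 2 = c * \sum_x Vr chiF r.+1 B x.
  by rewrite big_enum big_distrr /=; apply: eq_bigr => x _; rewrite sqr_sqrtr.
rewrite w2; apply: ler_pM; rewrite ?mulr_ge0 ?sumr_ge0 ?ler0n //.
- by move=> x _; rewrite Vr_ge0.
- under eq_bigr do rewrite -natrX -mulnn.
  rewrite -natr_sum ler_nat -card_pairs_key ?enum_uniq // => p; by rewrite mem_enum.
- by rewrite ler_wpM2l ?ler0n.
Qed.

End Burgess.

(** * Dirichlet characters as functions on the prime field *)

Section CharacterOnFp.
Variables (R : realType) (q : nat) (chi : int -> R[i]).
Hypotheses (q_prime : prime q) (dchi : dirichlet_character q chi)
  (nchi : ~ principal_character q chi).

Let pF : q \in [pchar 'F_q] := pchar_Fp q_prime.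

Definition char_Fp (x : 'F_q) : R[i] := chi (x : nat)%:Z.

Lemma dchar_periodM n k : chi (n + k * q%:Z) = chi n.
Proof.
have h m (j : nat) : chi (m + j%:Z * q%:Z) = chi m.
  elim: j => [|j IH]; first by rewrite mul0r addr0.
  by rewrite -addn1 PoszD mulrDl mul1r addrA (dchar_period dchi) IH.
case: k => j; first exact: h.
by rewrite -(h (n + Negz j * q%:Z) j.+1) NegzE mulNr subrK.
Qed.

Lemma char_FpE n : chi n = char_Fp n%:~R.
Proof.
rewrite /char_Fp; set x : 'F_q := n%:~R.
have : (q%:Z %| n - (x : nat)%:Z)%Z.
  rewrite -(intr_eq0_dvdz pF) rmorphB /= -pmulrn natr_Zp subrr //.
case/dvdzP => k hk; rewrite -(dchar_periodM (x : nat)%:Z k) -hk.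
by rewrite subrKC.
Qed.

Lemma char_Fp1 : char_Fp 1 = 1.
Proof. by rewrite -(dchar1 dchi) (char_FpE 1). Qed.

Lemma char_Fp0 : char_Fp 0 = 0.
Proof.
rewrite -(char_FpE 0); apply/(dchar_eq0 dchi).
by rewrite coprimezE /= /coprime gcd0n; have := prime_gt1 q_prime; case: (q) => [|[]].
Qed.

Lemma char_FpM x y : char_Fp (x * y) = char_Fp x * char_Fp y.
Proof.
have E (z : 'F_q) : z = ((z : nat)%:Z)%:~R by rewrite -pmulrn natr_Zp.
rewrite {1}(E x) {1}(E y) -rmorphM /= -char_FpE (dcharM dchi); by [].
Qed.

Lemma char_Fp_nontrivial : exists2 b, b != 0 & char_Fp b != 1.
Proof.
apply: contrapT => h; apply: nchi => n cn; rewrite char_FpE; apply/eqP.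
apply: contrapT => /negP hn; apply: h; exists n%:~R => //.
rewrite (intr_eq0_dvdz pF); apply/negP => dv.
move: cn; rewrite coprimezE /= coprime_sym prime_coprime //.
by move: dv; rewrite dvdzE /= => ->.
Qed.

End CharacterOnFp.

(** * Choice of parameters *)

Section Exponents.
Variable R : realType.

Lemma powR_expn (x a : R) n : 0 <= x -> (x `^ a) ^+ n = x `^ (a * n%:R).
Proof. by move=> x0; rewrite -powR_mulrn ?powR_ge0 // -powRrM. Qed.

Lemma ler_root (x y : R) n : (0 < n)%N -> 0 <= x -> 0 <= y ->
  x ^+ n <= y ^+ n -> x <= y.
Proof. by move=> n0 x0 y0; rewrite ler_pXn2r ?nnegrE. Qed.

(* With [Y ^ k = s], [s = sqrt q], the two terms of the moment bound are
   balanced up to a constant. *)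
Lemma balanced_moment k r (A B H D : nat) (s Y E C1 t : R) :
  r = k.+3 -> (0 < k)%N -> (0 < A)%N -> (0 < B)%N -> (0 < D)%N -> (A <= H)%N ->
  0 <= s -> B%:R <= Y -> s <= (2 * B%:R) ^+ k -> D%:R <= C1 * E ->
  (H <= 128 * A * B)%N -> 0 <= t ->
  t ^+ (2 * r) <= (A * H)%:R ^+ (2 * r.-1) * ((A ^ 2 + 3 * A * H * D)%:R *
     ((r ^ 2 * B ^ 3)%:R * ((B ^ r * r ^ (r + r))%:R * s ^+ 2 +
        ((2 * D + 4) * B ^ (2 * k + 3))%:R * ((r + r)%:R * s)))) ->
  (t / (A * B)%:R) ^+ (2 * r) <=
    (512 * (r ^ 2 * (r ^ (r + r) * 2 ^ k + 12 * r)))%:R * C1 ^+ 2 *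
    (H%:R ^+ (2 * r.-1) * (s * Y * E ^+ 2)).
Proof.
move=> hr k0 A0 B0 D0 AH s0 BY sB DE HAB t0 ht.
have H0 : (0 < H)%N by apply: leq_trans AH.
pose a : R := A%:R; pose b : R := B%:R; pose h : R := H%:R; pose d : R := D%:R.
have a0 : 0 < a by rewrite ltr0n.
have b0 : 0 < b by rewrite ltr0n.
have h0 : 0 < h by rewrite ltr0n.
have d1 : 1 <= d by rewrite ler1n.
(* [K1] comes from the diagonal term, where one [s] is replaced by [(2 * B) ^ k]; [K2] from
   [(2 * D + 4) * 2 r <= 12 r * D]. *)
pose K1 : R := (r ^ (r + r) * 2 ^ k)%:R; pose K2 : R := (12 * r)%:R.
have e1 : (A ^ 2 + 3 * A * H * D)%:R <= 4 * (a * h * d).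
  rewrite natrD natrX !natrM -/a -/h -/d.
  have ah : a <= h by rewrite ler_nat.
  have : a ^+ 2 <= a * h * d.
    rewrite expr2 -mulrA ler_wpM2l ?(ltW a0) //; apply: le_trans ah _.
    by rewrite ler_peMr // ltW.
  lra.
have e2 : b ^+ 3 * ((B ^ r * r ^ (r + r))%:R * s ^+ 2 +
        ((2 * D + 4) * B ^ (2 * k + 3))%:R * ((r + r)%:R * s)) <=
        (K1 + K2) * (d * b ^+ (2 * r) * s).
  rewrite mulrDr [X in _ <= X]mulrDl; apply: lerD.
    have -> : b ^+ 3 * ((B ^ r * r ^ (r + r))%:R * s ^+ 2) =
       (r ^ (r + r))%:R * (b ^+ (r + 3) * s * s).
      by rewrite natrM natrX -/b exprD; ring.
    rewrite /K1 (natrM _ (r ^ (r + r))) -[X in _ <= X]mulrA ler_wpM2l ?ler0n //.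
    rewrite [X in _ <= X]mulrA ler_wpM2r // natrX.
    have -> : 2 ^+ k * (d * b ^+ (2 * r)) = d * (b ^+ (r + 3) * (2 * b) ^+ k).
      have -> : (2 * r = r + 3 + k)%N by move: hr; clear; lia.
      by rewrite (exprD b (r + 3)) exprMn; ring.
    apply: (@le_trans _ _ (1 * (b ^+ (r + 3) * (2 * b) ^+ k))).
      by rewrite mul1r ler_wpM2l ?exprn_ge0 ?(ltW b0).
    by rewrite ler_wpM2r ?mulr_ge0 ?exprn_ge0 ?(ltW b0) // mulr_ge0 // ltW.
  have -> : b ^+ 3 * (((2 * D + 4) * B ^ (2 * k + 3))%:R * ((r + r)%:R * s)) =
     (2 * d + 4) * (2 * r%:R) * (b ^+ (2 * r) * s).
    have -> : (2 * r = 2 * k + 3 + 3)%N by move: hr; clear; lia.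
    have x1 : ((2 * D + 4) * B ^ (2 * k + 3))%:R = (2 * d + 4) * b ^+ (2 * k + 3).
      by rewrite natrM natrD natrM natrX.
    have x2 : (r + r)%:R = 2 * r%:R :> R by rewrite natrD; ring.
    by rewrite x1 x2 (exprD b (2 * k + 3) 3); ring.
  rewrite /K2 natrM -[d * _ * s]mulrA [X in _ <= X]mulrA ler_wpM2r ?mulr_ge0 ?exprn_ge0 ?(ltW b0) //.
  have : 0 <= r%:R * (d - 1) by rewrite mulr_ge0 ?ler0n // subr_ge0.
  lra.
have K0 : 0 <= K1 + K2 by rewrite addr_ge0 ?ler0n.
have ds0 : 0 <= d * b ^+ (2 * r) * s.
  by rewrite mulr_ge0 // mulr_ge0 ?exprn_ge0 ?(ltW b0) // (le_trans ler01).
pose r2 : R := (r ^ 2)%:R.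
have e3 : t ^+ (2 * r) <= (a * h) ^+ (2 * r.-1) * ((4 * (a * h * d)) *
     (r2 * ((K1 + K2) * (d * b ^+ (2 * r) * s)))).
  apply: le_trans ht _; rewrite natrM -/a -/h ler_wpM2l ?exprn_ge0 ?mulr_ge0 ?(ltW a0) ?(ltW h0) //.
  rewrite (natrM _ (r ^ 2)) (natrX _ B 3) -/b -/r2 -mulrA.
  apply: ler_pM => //.
    rewrite mulr_ge0 ?ler0n // mulr_ge0 ?exprn_ge0 ?(ltW b0) //.
    by rewrite addr_ge0 // mulr_ge0 ?ler0n // ?exprn_ge0 // mulr_ge0 ?ler0n.
  by rewrite ler_wpM2l ?ler0n.
rewrite natrM -/a -/b expr_div_n ler_pdivrMr ?exprn_gt0 ?mulr_gt0 //.
apply: le_trans e3 _.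
have d0 : 0 <= d by apply: le_trans d1.
have dE2 : d ^+ 2 <= C1 ^+ 2 * E ^+ 2.
  by rewrite -exprMn; apply: lerXn2r => //; rewrite nnegrE // (le_trans d0).
have hab : h <= 128 * a * b by rewrite -!natrM ler_nat.
have rE : (2 * r = (2 * r.-1).+2)%N by move: hr; clear; lia.
have -> : (a * h) ^+ (2 * r.-1) * ((4 * (a * h * d)) *
     (r2 * ((K1 + K2) * (d * b ^+ (2 * r) * s)))) =
  (4 * r2 * (K1 + K2)) * (h ^+ (2 * r.-1) * s * b ^+ (2 * r) * a ^+ (2 * r.-1)) * (a * h * d ^+ 2).
  by rewrite exprMn; ring.
(* [512 = 4 * 128]: the [4] is from [e1], the [128] from trading one factor [H] for
   [128 * A * B]. *)
have -> : (512 * (r ^ 2 * (r ^ (r + r) * 2 ^ k + 12 * r)))%:R * C1 ^+ 2 *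
    (h ^+ (2 * r.-1) * (s * Y * E ^+ 2)) * (a * b) ^+ (2 * r) =
  (4 * r2 * (K1 + K2)) * (h ^+ (2 * r.-1) * s * b ^+ (2 * r) * a ^+ (2 * r.-1)) *
    (128 * a ^+ 2 * Y * (C1 ^+ 2 * E ^+ 2)).
  rewrite natrM (natrM _ (r ^ 2)) -/r2 natrD -/K1 -/K2 exprMn.
  have -> : a ^+ (2 * r) = a ^+ (2 * r.-1) * a ^+ 2 by rewrite -exprD rE addn2.
  ring.
apply: ler_wpM2l.
  apply: mulr_ge0; first by rewrite mulr_ge0 // mulr_ge0 ?ler0n.
  by rewrite !mulr_ge0 ?exprn_ge0 ?(ltW a0) ?(ltW b0) ?(ltW h0).
apply: ler_pM; rewrite ?mulr_ge0 ?exprn_ge0 ?(ltW a0) ?(ltW h0) //.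
apply: (@le_trans _ _ (a * (128 * a * b))); first by rewrite ler_wpM2l ?(ltW a0).
have -> : a * (128 * a * b) = 128 * a ^+ 2 * b by ring.
by rewrite ler_wpM2l // mulr_ge0 ?exprn_ge0 ?(ltW a0).
Qed.

End Exponents.

(** * The bound for sums over integer intervals *)

Section Core.
Variables (R : realType) (k : nat) (eps : R).
Hypotheses (k_gt0 : (0 < k)%N) (eps_gt0 : 0 < eps).
Local Notation r := k.+3.
Local Notation rR := (k.+3%:R : R).

Definition saving (q : nat) : R :=
  q%:R `^ ((rR - 2) / (4 * rR * (rR - 3)) + eps).

Definition Hpow (h : R) : R := h `^ (1 - 1 / rR).

Let kR0 : 0 < (k%:R : R).
Proof. by rewrite ltr0n. Qed.

Let rk : rR = k%:R + 3.
Proof. by rewrite -addn3 natrD. Qed.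

Let rE : (2 * k.+3 = 2 * k.+3.-1 + 2)%N.
Proof. by clear; lia. Qed.

Lemma Hpow_pow (h : nat) : (0 < h)%N -> Hpow h%:R ^+ (2 * r) = h%:R ^+ (2 * r.-1).
Proof.
move=> h0; rewrite /Hpow powR_expn ?ler0n // -powR_mulrn ?ler0n //; congr (_ `^ _).
rewrite (_ : r.-1 = k.+2) // natrM natrM rk -(addn2 k) natrD; field.
by rewrite gt_eqF //; lra.
Qed.

(** Matches the output of [balanced_moment], with [E = q^(r eps)]; the divisor bound is therefore
    used with exponent [r * eps]. *)
Lemma saving_pow (q : nat) : (0 < q)%N ->
  saving q ^+ (2 * r) =
  Num.sqrt q%:R * q%:R `^ (1 / (2 * k%:R)) * (q%:R `^ (rR * eps)) ^+ 2.
Proof.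
move=> q0; have qn0 : (q%:R : R) != 0 by rewrite pnatr_eq0 -lt0n.
rewrite /saving powR_expn ?ler0n // -powR12_sqrt ?ler0n // powR_expn ?ler0n //.
rewrite -!powRD ?qn0 ?implybT //; congr (_ `^ _).
rewrite natrM rk; field.
by rewrite !gt_eqF //; lra.
Qed.

(** Strong induction on [h]. The condition on [h] is hereditary, and its factor [4] leaves room for
    windows with up to [2 H] integers. In [128 * C2] the moment uses [C2] and the shift errors
    [2 * 128 / 8 = 32] times [C2]. *)
Lemma core_bound : exists2 C : R, 0 < C &
  forall (f : {poly R}) (q : nat) (chi : int -> R[i]) (N : int) (h : nat),
    (size f <= 3)%N -> prime q -> dirichlet_character q chi ->
    ~ principal_character q chi ->
    (h%:R : R) ^+ 2 < 4 * (q%:R * q%:R `^ (1 / (2 * k%:R))) ->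
    nm (isum chi f N h) <= C * (Hpow h%:R * saving q).
Proof.
have re0 : 0 < rR * eps by rewrite mulr_gt0 // ltr0n.
have [C1 C11 hC1] := divisor_bound re0.
pose K : R := (512 * (r ^ 2 * (r ^ (r + r) * 2 ^ k + 12 * r)))%:R.
have K1 : 1 <= K by rewrite ler1n muln_gt0 /= muln_gt0 expn_gt0 /= addn_gt0 orbC muln_gt0.
pose C2 := K * C1 ^+ 2.
have C21 : 1 <= C2 by rewrite /C2 mulr_ege1 // exprn_ege1.
have C2E : K * C1 ^+ 2 = C2 by [].
clearbody C2.
exists (128 * C2); first by rewrite mulr_gt0 // (lt_le_trans ltr01).
move=> f q chi N h sf qp dchi nchi.
have q0 := prime_gt0 qp; have q1 := prime_gt1 qp.
pose Q : R := q%:R.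
have Q1 : 1 <= Q by rewrite ler1n.
have Q0 : 0 < Q by rewrite ltr0n.
pose Y := Q `^ (1 / (2 * k%:R)).
pose s := Num.sqrt Q.
pose E := Q `^ (rR * eps).
pose U := saving q.
have powge1 a : 0 <= a -> 1 <= Q `^ a by move=> a0; rewrite -(powRr0 Q) ler_powR.
have Y1 : 1 <= Y by apply: powge1; rewrite divr_ge0 // mulr_ge0 // ltW.
have E1 : 1 <= E by apply: powge1; rewrite ltW.
have s1 : 1 <= s by rewrite -sqrtr1 ler_sqrt // ltW.
have Y0 : 0 <= Y := le_trans ler01 Y1.
have E0 : 0 <= E := le_trans ler01 E1.
have s0 : 0 <= s := le_trans ler01 s1.
have C20 : 0 <= C2 := le_trans ler01 C21.
have C10 : 0 <= C1 := le_trans ler01 C11.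
have s2 : s ^+ 2 = Q by rewrite sqr_sqrtr // ltW.
have Yk : Y ^+ k = s.
  rewrite /Y powR_expn ?(ltW Q0) // /s -powR12_sqrt ?(ltW Q0) //; congr (_ `^ _).
  by field; rewrite gt_eqF.
have Ys : Y <= s.
  by rewrite -Yk -[X in X <= _]expr1 ler_weXn2l.
have U0 : 0 <= U by apply: powR_ge0.
have UE : U ^+ (2 * r) = s * Y * E ^+ 2 by apply: saving_pow.
have X0 (x : R) : 0 <= Hpow x by apply: powR_ge0.
elim/ltn_ind: h N => h IH N hQ.
have [->|h0] := posnP h.
  by rewrite /isum big_ord0 nm0 !mulr_ge0.
have hE := Hpow_pow h0.
have h1 : (1 : R) <= h%:R by rewrite ler1n.
have nmchi n : nm (chi n) <= 1.
  by rewrite (char_FpE qp dchi) (nm_chi_le1 qp (card_Fp qp) (char_Fp1 qp dchi) (char_Fp0 qp dchi) (char_FpM qp dchi)).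
(* Below [128 * sqrt (s * Y)] the trivial bound [h] suffices; above it [A] is positive. *)
have [triv|ntriv] := leP (h%:R ^+ 2) (128 ^+ 2 * (s * Y)).
  apply: (@le_trans _ _ h%:R).
    apply: le_trans (nm_sum _ _ _) _; rewrite -[X in _ <= X%:R](card_ord h) -sum1_card natr_sum.
    by apply: ler_sum => i _; rewrite nmM nm_e mul1r.
  apply: (@ler_root R _ _ (2 * r)) => //.
    by rewrite !mulr_ge0.
  rewrite -/U [(128 * C2 * _) ^+ _]exprMn [(Hpow _ * _) ^+ _]exprMn hE UE {1}rE exprD mulrCA ler_wpM2l ?exprn_ge0 ?ler0n //.
  apply: le_trans triv _.
  apply: ler_pM; rewrite ?mulr_ge0 //.
    apply: (@le_trans _ _ ((128 * C2) ^+ 2)).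
      by apply: lerXn2r; rewrite ?nnegrE ?mulr_ge0 // ler_peMr.
    apply: ler_weXn2l; last exact: leq_pmulr.
    by apply: mulr_ege1 => //; rewrite ler1n.
  by rewrite ler_peMr ?mulr_ge0 // exprn_ege1.
(* [Y ^+ k = s] is the balancing point; rounding down loses at most a factor [2]. *)
pose B := Num.truncn Y.
have BY : B%:R <= Y by rewrite truncn_le //.
have YB : Y < B%:R + 1 by rewrite natr1 truncnS_gt.
have B0 : (0 < B)%N.
  by rewrite truncn_gt0.
clearbody B.
have B1 : (1 : R) <= B%:R by rewrite ler1n.
have Y2B : Y <= 2 * B%:R by move: YB B1; move: (B%:R : R) => b; lra.
have sB : s <= (2 * B%:R) ^+ k.
  by rewrite -Yk; apply: lerXn2r; rewrite ?nnegrE ?mulr_ge0.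
have Bs : B%:R <= s by apply: le_trans Ys.
have BQ : (B ^ 2 <= q)%N.
  by rewrite -(ler_nat R) natrX -/Q -s2; apply: lerXn2r; rewrite ?nnegrE ?ler0n.
have Bq : (B <= q)%N by apply: leq_trans BQ; rewrite expnS expn1 leq_pmulr.
have hB : (128 * B <= h)%N.
  rewrite -(ler_nat R); apply: (@ler_root R _ _ 2) => //.
  apply: le_trans (ltW ntriv); rewrite natrM exprMn ler_wpM2l //.
  by rewrite expr2; apply: ler_pM => //.
(* The [64] makes the error sums have length at most [h / 32], and gives [8 * A * h <= q] from the
   hypothesis on [h]. *)
pose A := (h %/ (64 * B))%N.
have B64 : (0 < 64 * B)%N by rewrite muln_gt0.
have AhB : (A * (64 * B) <= h)%N by apply: leq_divM.
have A0 : (0 < A)%N.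
  by rewrite divn_gt0 //; apply: leq_trans hB; rewrite leq_mul2r orbT.
have hAB : (h <= 128 * A * B)%N.
  have := ltn_ceil h B64; rewrite -/A => h2.
  apply: leq_trans (ltnW h2) _; rewrite mulSn.
  have -> : (128 * A * B = A * (64 * B) + A * (64 * B))%N by ring.
  by rewrite leq_add2r leq_pmull.
have Ah : (A <= h)%N by apply: leq_trans AhB; rewrite leq_pmulr.
have AHq : (8 * A * h <= q)%N.
  rewrite -(ler_nat R) -/Q.
  have b0 : 0 < (B%:R : R) by rewrite ltr0n.
  rewrite -(ler_pM2r (_ : 0 < 8 * B%:R)) ?mulr_gt0 //.
  have e1 : (8 * A * h)%:R * (8 * B%:R) <= h%:R ^+ 2 :> R.
    rewrite -!natrM expr2 -natrM ler_nat.
    have -> : (8 * A * h * (8 * B) = A * (64 * B) * h)%N by ring.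
    by rewrite leq_mul2r AhB orbT.
  apply: le_trans e1 _; apply: le_trans (ltW hQ) _; rewrite -/Q -/Y.
  have -> : Q * (8 * B%:R) = 4 * (Q * (2 * B%:R)) by ring.
  by rewrite ler_wpM2l // ler_wpM2l // ltW.
have AHq4 : (4 * A * h <= q)%N by apply: leq_trans AHq; rewrite !leq_mul2r !orbT.
have Aq : (2 * A < q)%N.
  have : (8 * A <= 8 * A * h)%N by rewrite leq_pmulr.
  by move/leq_trans => /(_ _ AHq); apply: leq_trans; rewrite ltn_pmul2r.
pose D := Num.truncn (C1 * E).
have CE1 : 1 <= C1 * E by rewrite mulr_ege1.
have CE0 : 0 <= C1 * E := le_trans ler01 CE1.
have D_le : D%:R <= C1 * E by rewrite truncn_le //.
have tauD m : (0 < m)%N -> (m <= q)%N -> (tau m <= D)%N.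
  move=> m0 mq; rewrite /D truncn_ge_nat //.
  apply: le_trans (hC1 m m0) _; rewrite ler_wpM2l //.
  by apply: powR_le2l; rewrite ?ler_nat // ltW.
have D0 : (0 < D)%N.
  by rewrite /D truncn_gt0.
have mono : nm (isum chi f N h) <= (\sum_p nm (@window_sum R chi f A B h N p)) / (A * B)%:R
    + 2 * (128 * C2 * (Hpow h%:R * U) / 8).
  (* Shortening by [32] reduces [Hpow] by at least [8], because [8 ^ (2 r) <= 32 ^ (2 (r - 1))]. *)
  apply: isum_window_bound => // N' h' hh'.
  have hh : (32 * h' <= h)%N.
    apply: leq_trans AhB; have -> : (A * (64 * B) = 32 * (2 * A * B))%N by ring.
    by rewrite leq_mul2l hh' orbT.
  have hh1 : (h' < h)%N by move: hh h0; clear; lia.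
  apply: le_trans (IH h' hh1 N' _) _.
    apply: le_lt_trans hQ; apply: lerXn2r; rewrite ?nnegrE ?ler0n // ler_nat; exact: ltnW.
  rewrite -[X in _ <= X]mulrA ler_wpM2l ?mulr_ge0 // mulrAC ler_wpM2r //.
  have [->|h'0] := posnP h'.
    rewrite /Hpow powR0 ?divr_ge0 // ?X0 //.
    by rewrite gt_eqF // subr_gt0 ltr_pdivrMr ?ltr0n // mul1r ltr1n.
  apply: (@ler_root R _ _ (2 * r)) => //; first by rewrite divr_ge0.
  rewrite expr_div_n Hpow_pow // hE ler_pdivlMr ?exprn_gt0 //.
  apply: (@le_trans _ _ ((32 * h')%:R ^+ (2 * r.-1))); last first.
    by apply: lerXn2r; rewrite ?nnegrE ?ler0n // ler_nat.
  rewrite natrM exprMn mulrC ler_wpM2r ?exprn_ge0 ?ler0n // -!natrX ler_nat.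
  have -> : (8 = 2 ^ 3)%N by []. have -> : (32 = 2 ^ 5)%N by [].
  by rewrite -!expnM leq_exp2l //; clear; lia.
set t := \sum_p _ in mono.
have t0 : 0 <= t by apply: sumr_ge0 => p _; apply: nm_ge0.
pose ext j := @Fp_extension q j qp.
have VS := sum_Vr_bound qp (card_Fp qp) (pchar_Fp qp) (char_Fp1 qp dchi) (char_Fp0 qp dchi)
  (char_FpM qp dchi) (char_Fp_nontrivial qp dchi nchi) ext (_ : 0 < r)%N Bq
  (vinogradov_mean_value k (D := D) (fun m m0 mB => tauD m m0 (leq_trans mB BQ))).
have NU := card_quot_pairs qp (pchar_Fp qp) N A0 AHq4
  (fun m m0 mA => tauD m m0 (leq_trans mA (ltnW Aq))).
have mom := burgess_moment qp (card_Fp qp) (pchar_Fp qp) (char_Fp1 qp dchi)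
  (char_FpM qp dchi) (char_FpE qp dchi) sf (_ : 0 < r)%N Bq Aq NU (VS isT).
have {}mom := mom isT; rewrite -/t -/Q -/s -s2 in mom.
have bal := balanced_moment (erefl _) k_gt0 A0 B0 D0 Ah (le_trans ler01 s1) BY sB D_le hAB t0 mom.
have main : t / (A * B)%:R <= C2 * (Hpow h%:R * U).
  apply: (@ler_root R _ _ (2 * r)) => //.
  - by rewrite divr_ge0 ?ler0n.
  - by rewrite !mulr_ge0.
  apply: le_trans bal _; rewrite -/K C2E [(C2 * _) ^+ _]exprMn [(Hpow _ * _) ^+ _]exprMn hE UE.
  rewrite ler_wpM2r //.
    by rewrite mulr_ge0 ?exprn_ge0 ?ler0n // !mulr_ge0 ?exprn_ge0.
  by rewrite -{1}[C2]expr1 ler_weXn2l.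
have XU0 : 0 <= C2 * (Hpow h%:R * U) by rewrite !mulr_ge0.
apply: le_trans mono _; rewrite -/U -!(mulrA 128); move: main XU0.
by move: (C2 * (Hpow h%:R * U)) (t / _) => c d; lra.
Qed.

End Core.

Lemma mixed_sum_isum (R : realType) (f : {poly R}) (chi : int -> R[i]) (N H : R) :
  0 <= H ->
  mixed_sum f chi N H =
  isum chi f (Num.floor N + 1) (absz (Num.floor (N + H) - Num.floor N)%R).
Proof.
move=> H0; set a := Num.floor N; set b := Num.floor (N + H).
have ab : a <= b by apply: le_floor; rewrite lerDl.
pose g (i : nat) : int := a + 1 + i%:Z.
rewrite /mixed_sum /isum (reindex_fsbig g (`I_(absz (b - a)%R))%classic).
  by rewrite -fsbig_ord; apply: eq_bigr => i _.
split.
- move=> i /= hi; apply/andP; split.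
    by rewrite -floor_lt_int -/a /g; lia.
  by rewrite -floor_ge_int -/b /g; lia.
- by move=> i j _ _ /= /addrI[].
move=> n /= /andP[]; rewrite -floor_lt_int -floor_ge_int -/a -/b => an nb.
by exists (absz (n - a - 1)%R); rewrite /g; move: (n : int) an nb => n' an nb; lia.
Qed.

Theorem theorem1p5 (R : realType) (r : nat) (hr : (4 <= r)%N)
    (eps : R) (heps : 0 < eps) :
  exists2 C : R, 0 < C &
    forall (f : {poly R}) (q : nat) (chi : int -> R[i]) (H N : R),
      size f = 3%N ->
      prime q ->
      dirichlet_character q chi ->
      ~ principal_character q chi ->
      H < q%:R `^ (1 / 2 + 1 / (4 * (r%:R - 3))) ->
      N \is a Num.int \/ 1 <= H ->
      `|mixed_sum f chi N H| <=
        (C * (H `^ (1 - 1 / r%:R) *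
              q%:R `^ ((r%:R - 2) / (4 * r%:R * (r%:R - 3)) + eps)))%:C.
Proof.
have [k k0 rE] : exists2 k, (0 < k)%N & r = k.+3 by exists (r - 3)%N; lia.
rewrite {r hr}rE.
have [C C0 hC] := core_bound k0 heps.
(* The window has at most [2 * H] integers, and [(2 H)^a <= 2 H^a] for an exponent [a] at most
   [1]. *)
exists (2 * C); first by rewrite mulr_gt0.
move=> f q chi H N sf qp dchi nchi Hq NH.
have q0 := prime_gt0 qp.
have Q0 : 0 < (q%:R : R) by rewrite ltr0n.
have kR : (k.+3%:R : R) - 3 = k%:R by rewrite -addn3 natrD addrK.
have kR0 : 0 < (k%:R : R) by rewrite ltr0n.
have [H0|H0] := ltP H 0.
  rewrite /mixed_sum (_ : int_window N H = set0) ?fsbig_set0 ?normr0.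
    by rewrite ler0c !mulr_ge0 ?powR_ge0 // ltW.
  by rewrite -subset0 => n /= /andP[h1 h2]; move: (lt_le_trans h1 h2); lra.
rewrite mixed_sum_isum // nmE lecR.
set h := absz _; set n0 := Num.floor N + 1.
have hE : h%:R = (Num.floor (N + H) - Num.floor N)%:~R :> R.
  by rewrite pmulrn /h gez0_abs // subr_ge0 le_floor // lerDl.
(* An integer [N] gives at most [H] integers in the window; otherwise there are fewer than [H + 1],
   which is at most [2 * H] when [H >= 1]. *)
have h2H : h%:R <= 2 * H.
  rewrite hE rmorphB /=; have u1 := floor_le (N + H).
  case: NH => [Nint|H1]; first by rewrite (floorK Nint); lra.
  have := floorD1_gt N; rewrite rmorphD /=; lra.
have hQ : (h%:R : R) ^+ 2 < 4 * (q%:R * q%:R `^ (1 / (2 * k%:R))).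
  apply: (@le_lt_trans _ _ ((2 * H) ^+ 2)).
    by apply: lerXn2r; rewrite ?nnegrE ?ler0n ?mulr_ge0.
  rewrite exprMn (_ : 2 ^+ 2 = 4) ?ltr_pM2l //; last by ring.
  apply: (@lt_le_trans _ _ ((q%:R `^ (1 / 2 + 1 / (4 * k%:R))) ^+ 2)).
    by apply: ltrXn2r => //; rewrite -kR.
  have -> : q%:R * q%:R `^ (1 / (2 * k%:R)) = q%:R `^ (1 + 1 / (2 * k%:R)) :> R.
    by rewrite powRD ?(gt_eqF Q0) ?implybT // powRr1 // ltW.
  rewrite powR_expn ?(ltW Q0) //.
  rewrite le_eqVlt; apply/orP; left; apply/eqP; congr (_ `^ _).
  by field; rewrite gt_eqF.
apply: le_trans (hC f q chi n0 h _ qp dchi nchi hQ) _; first by rewrite sf.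
rewrite -/(saving k eps q) (mulrC 2) -mulrA ler_wpM2l ?(ltW C0) // mulrA ler_wpM2r ?powR_ge0 //.
rewrite /Hpow; set a := 1 - _.
have a01 : 0 <= a <= 1.
  have r1 : 1 <= (k.+3%:R : R) by rewrite ler1n.
  have : 0 <= 1 / (k.+3%:R : R) <= 1.
    by rewrite divr_ge0 // ler_pdivrMr ?mul1r // (lt_le_trans ltr01).
  by rewrite /a; move: (1 / _) => z /andP[z0 z1]; rewrite subr_ge0 z1 gerBl z0.
case/andP: a01 => a0 a1.
apply: le_trans (powR_le2l a0 (ler0n _ _) h2H) _.
rewrite powRM // ler_wpM2r ?powR_ge0 //.
by rewrite -[X in _ <= X]powRr1 // ler_powR // ler1n.
Qed.
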